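(* Let $f:(\mathbb R,0)\to(\mathbb R^m,0)$ be the germ of a parameterized quasi-homogeneous curve. The space of germs of liftable vector fields over $f$ which act nontrivially on the space of algebraic restrictions of closed $2$-forms to $f$ is a finite dimensional vector space.
   Context: A curve-germ $f:(\mathbb R,0)\to(\mathbb R^m,0)$ is quasi-homogeneous if there exist a coordinate $t$ on $(\mathbb R,0)$, coordinates $(x_1,\dots,x_m)$ on $(\mathbb R^m,0)$ and positive integers $(\lambda_1,\dots,\lambda_m)$ (weights) such that $df(t\frac{d}{dt})=E\circ f$, where $E=\sum_{i=1}^m\lambda_ix_i\frac{\partial}{\partial x_i}$. A germ $X$ of a vector field on $(\mathbb R^m,0)$ is liftable over $f$ if there is a function-germ $g$ on $(\mathbb R,0)$ with $g\,\frac{df}{dt}=X\circ f$. A germ of a $k$-form vanishes on $f$ if all its coefficients vanish at $f(t)$ for all $t$ near $0$. Germs of $k$-forms $\omega_1,\omega_2$ have the same algebraic restriction to $f$ if $\omega_1-\omega_2=\alpha+d\beta$ with $\alpha$ a $k$-form vanishing on $f$ and $\beta$ a $(k-1)$-form vanishing on $f$; the equivalence class of $\omega$ is its algebraic restriction to $f$, denoted $[\omega]_f$. For $X$ liftable over $f$ the Lie derivative $\mathcal L_X[\omega]_f:=[\mathcal L_X\omega]_f$ is well defined. A germ $X$ of a liftable vector field acts trivially on the space of algebraic restrictions of closed $2$-forms if $\mathcal L_Xa=0$ for every algebraic restriction $a$ to $f$ of a closed $2$-form; otherwise it acts nontrivially. *)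

(* Defs.v *)
From HB Require Import structures.
From mathcomp Require Import all_boot all_order all_algebra.
From mathcomp Require Import all_classical all_reals all_analysis.

Set Implicit Arguments.
Unset Strict Implicit.
Unset Printing Implicit Defensive.

Import Order.TTheory GRing.Theory Num.Theory.
Import numFieldNormedType.Exports.

Local Open Scope classical_set_scope.
Local Open Scope ring_scope.

(* A germ at 0 is represented by a total function, whose values away from 0
   are irrelevant: every predicate below depends only on the restriction of
   its arguments to an arbitrarily small neighbourhood of 0.  Germs (of curves,
   functions, vector fields, forms) are of class C^infinity. *)

Section Germs.
Context {R : realType}.

(* The iterated directional derivative D_{v_1} ... D_{v_n} F. *)
Definition iter_dderive {V W : normedModType R} (s : seq V) (F : V -> W) :
  V -> W := foldr (fun v G => 'D_v G) F s.

(* F is of class C^infinity on a neighbourhood of 0 (V finite-dimensional):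
   the neighbourhood does not depend on the order of differentiation. *)
Definition smooth_germ {V W : normedModType R} (F : V -> W) : Prop :=
  \forall x \near (0 : V), forall s : seq V,
    {for x, continuous (iter_dderive s F)} /\
    forall v : V, derivable (iter_dderive s F) x v.

(* A local coordinate system chi on (V, 0), with inverse psi. *)
Definition coordinates {V : normedModType R} (chi psi : V -> V) : Prop :=
  [/\ smooth_germ chi, smooth_germ psi, chi 0 = 0, psi 0 = 0 &
      (\forall x \near (0 : V), psi (chi x) = x) /\
      (\forall y \near (0 : V), chi (psi y) = y)].

(* The vector field whose expression in the coordinates chi is W. *)
Definition field_in_coordinates {V : normedModType R} (chi psi : V -> V)
    (W : V -> V) : V -> V :=
  fun x => 'D_(W (chi x)) psi (chi x).

Section Curve.
Context {m : nat}.
Implicit Types (f : R -> 'rV[R]_m) (X : 'rV[R]_m -> 'rV[R]_m).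

Definition curve_germ f : Prop := smooth_germ f /\ f 0 = 0.

(* The coordinate expression of E = \sum_i lambda_i x_i d/dx_i. *)
Definition euler_field (lambda : 'I_m -> nat) (x : 'rV[R]_m) : 'rV[R]_m :=
  \row_i ((lambda i)%:R * x 0 i).

(* tau is the coordinate t on (R, 0), and the coordinate expression of
   t d/dt is the identity. *)
Definition quasi_homogeneous f : Prop :=
  exists (tau sigma : R -> R) (chi psi : 'rV[R]_m -> 'rV[R]_m)
         (lambda : 'I_m -> nat),
    [/\ coordinates tau sigma, coordinates chi psi,
        (forall i, (0 < lambda i)%N) &
        let tdt := field_in_coordinates tau sigma id in
        let E := field_in_coordinates chi psi (euler_field lambda) in
        \forall t \near (0 : R), 'D_(tdt t) f t = E (f t)].

Definition liftable f X : Prop :=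
  smooth_germ X /\
  exists2 g : R -> R, smooth_germ g &
    \forall t \near (0 : R), g t *: derive1 f t = X (f t).

(* w x V is the value at x of the form w on the rows of V. *)
Definition form k := 'rV[R]_m -> 'M[R]_(k, m) -> R.

Definition zero_form {k} : form k := fun _ _ => 0.

Definition alternating_multilinear {k} (w : 'M[R]_(k, m) -> R) : Prop :=
  (forall (A B C : 'M[R]_(k, m)) (i : 'I_k) (b c : R),
      row i A = b *: row i B + c *: row i C ->
      row' i B = row' i A -> row' i C = row' i A ->
      w A = b * w B + c * w C) /\
  (forall (A : 'M[R]_(k, m)) (i j : 'I_k),
      i != j -> row i A = row j A -> w A = 0).

(* The coefficient w(e_{s 0}, ..., e_{s (k-1)}). *)
Definition form_coef {k} (w : form k) (s : 'I_k -> 'I_m) : 'rV[R]_m -> R :=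
  fun x => w x (rowsub s 1%:M).

Definition form_germ {k} (w : form k) : Prop :=
  (\forall x \near (0 : 'rV[R]_m), alternating_multilinear (w x)) /\
  forall s : 'I_k -> 'I_m, smooth_germ (form_coef w s).

Definition ext_d {k} (w : form k) : form k.+1 :=
  fun x V => \sum_(i < k.+1)
    (-1) ^+ i * 'D_(row i V) (fun y => w y (row' i V)) x.

Definition closed_form {k} (w : form k) : Prop :=
  \forall x \near (0 : 'rV[R]_m), forall V, ext_d w x V = 0.

(* (L_X w)(v_1, ..., v_k) = D_X (w(v_1, ..., v_k))
     + \sum_i w(v_1, ..., D_{v_i} X, ..., v_k)   for constant v_1, ..., v_k,
   i.e. d/ds at s = 0 of the pullback of w by the flow of X. *)
Definition lie_derivative {k} X (w : form k) : form k :=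
  fun x V => 'D_(X x) (fun y => w y V) x +
    \sum_(i < k)
      w x (\matrix_(j < k) if j == i then 'D_(row i V) X x else row j V).

Definition vanishes_on {k} f (w : form k) : Prop :=
  \forall t \near (0 : R), forall s : 'I_k -> 'I_m, form_coef w s (f t) = 0.

Definition same_algebraic_restriction {k} f (w1 w2 : form k.+1) : Prop :=
  exists (alpha : form k.+1) (beta : form k),
    [/\ form_germ alpha, form_germ beta, vanishes_on f alpha,
        vanishes_on f beta &
        \forall x \near (0 : 'rV[R]_m), forall V,
          w1 x V - w2 x V = alpha x V + ext_d beta x V].

Definition acts_trivially f X : Prop :=
  forall w : form 2, form_germ w -> closed_form w ->
    same_algebraic_restriction f (lie_derivative X w) zero_form.

End Curve.

Definition linear_subspace {V : lmodType R} (L : set V) : Prop :=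
  L 0 /\ forall (a : R) (u v : V), L u -> L v -> L (a *: u + v).

(* L / T is a finite-dimensional vector space: T is a subspace of the vector
   space L and finitely many elements of L span L modulo T.  For spaces of
   representatives of germs such that T contains the representatives of the
   zero germ, L / T is also the quotient of the spaces of germs. *)
Definition finite_dimensional_quotient {V : lmodType R} (L T : set V) : Prop :=
  [/\ linear_subspace L, linear_subspace T, T `<=` L &
      exists (n : nat) (e : 'I_n -> V), (forall i, L (e i)) /\
        forall v, L v -> exists c : 'I_n -> R, T (v - \sum_(i < n) c i *: e i)].

End Germs.

(* Main.v *)
Require Import Defs.
From HB Require Import structures.
From mathcomp Require Import all_boot all_order all_algebra.
From mathcomp Require Import all_classical all_reals all_analysis.
From mathcomp Require Import ring lra.
Import Order.TTheory GRing.Theory Num.Theory.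
Import numFieldNormedType.Exports.
Local Open Scope classical_set_scope.
Local Open Scope ring_scope.

Set Implicit Arguments.
Unset Strict Implicit.
Unset Printing Implicit Defensive.

(** In the quasi-homogeneous coordinates [y_i] the curve is
    [y_i = c_i tau^lambda_i].  Restrictions of 2-forms being zero is a condition
    linear over the functions, and it contains [dp /\ eta] for every function
    [p] vanishing on the curve.  If [c_o <> 0], the binomials
    [c_i^lambda_o y_o^lambda_i - c_o^lambda_i y_i^lambda_o] vanish on the
    curve, their differentials express [y_i^(lambda_o - 1) dy_i] through [dy_o],
    and [dy_o /\ dy_o = 0] gives that [y_o^(lambda_i + lambda_j) dy_i /\ dy_j]
    has zero restriction; if [c_o = 0] already [y_o] vanishes on the curve.
    Hence every 2-form with coefficients in a high power of the maximal ideal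
    has zero restriction.  If the components of [X] lie in a high power of the
    maximal ideal, so do the coefficients of [L_X w], and [X] acts trivially:
    the quotient is bounded by a space of jets of vector fields.  Powers of
    the maximal ideal are handled by Hadamard's lemma, whose coefficients
    [int_0^1 d_k g (s x) ds] are smooth by differentiation under the integral. *)

(** * Differentiability classes *)

(** Smoothness is given through directional derivatives only, so Fréchet differentiability and the
    chain rule have to be recovered before anything can be carried from one coordinate system to
    another. Each component of the curve is a monomial because quasi-homogeneity becomes the
    equation [s F' = lambda_i F], whose smooth solutions near 0 are the multiples of [s^lambda_i].
    The binomials by themselves only kill [y_i^(lambda_o-1) y_j^(lambda_o-1) dy_i /\ dy_j]. After
    multiplication by [y_i y_j] the coefficient is [y_i^lambda_o y_j^lambda_o], which on the curve
    is proportional to [y_o^(lambda_i+lambda_j)]; what vanishes on the curve can be added freely, so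
    a pure power of [y_o] results. The last obstacle is linear algebra: the jets that span all
    vector fields modulo those of high order need not be liftable, whereas the generators of the
    quotient must be. An exchange argument replaces them by liftable ones. *)

Section SmoothCalculus.
Context {R : realType}.
Implicit Types V W : normedModType R.

(** Recursion on the order turns stability under products and compositions into a one-step
    induction: the derivative of a compound is a compound of functions of lower order. *)
Fixpoint Ck V W (U : set V) (n : nat) (F : V -> W) : Prop :=
  (forall x, U x -> {for x, continuous F}) /\
  if n is n'.+1 then
    (forall x v, U x -> derivable F x v) /\ forall v, Ck U n' ('D_v F)
  else True.

Lemma Ck_continuous V W (U : set V) n (F : V -> W) x :
  Ck U n F -> U x -> {for x, continuous F}.
Proof. by case: n => [|n] [cF _] Ux; exact: cF. Qed.

Lemma Ck_derivable V W (U : set V) n (F : V -> W) x v :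
  Ck U n.+1 F -> U x -> derivable F x v.
Proof. by move=> [_ [dF _]]; exact: dF. Qed.

Lemma Ck_derive V W (U : set V) n (F : V -> W) v :
  Ck U n.+1 F -> Ck U n ('D_v F).
Proof. by move=> [_ [_ DF]]; exact: DF. Qed.

Lemma Ck_pred V W (U : set V) n (F : V -> W) : Ck U n.+1 F -> Ck U n F.
Proof.
elim: n F => [|n IH] F [cF [dF DF]]; split=> //.
by split=> // v; apply: IH.
Qed.

Lemma Ck_le V W (U : set V) k n (F : V -> W) :
  (k <= n)%N -> Ck U n F -> Ck U k F.
Proof.
elim: n => [|n IH]; first by case: k.
by rewrite leq_eqVlt => /orP[/eqP->//|kn] /Ck_pred; apply: IH.
Qed.

Lemma Ck_subset V W (U U' : set V) n (F : V -> W) :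
  U' `<=` U -> Ck U n F -> Ck U' n F.
Proof.
move=> UU'; elim: n F => [|n IH] F [cF dF]; split.
- by move=> x /UU' Ux; exact: cF.
- by [].
- by move=> x /UU' Ux; exact: cF.
- by case: dF => dF DF; split=> [x v /UU'|v]; [exact: dF|exact/IH/DF].
Qed.

(** Since [U] is open, equality on [U] is equality near each of its points, which is all that
    derivatives see. The later inductions use this to replace ['D_v F] by an explicit formula. *)
Lemma Ck_eq V W (U : set V) n (F G : V -> W) : open U ->
  {in U, F =1 G} -> Ck U n F -> Ck U n G.
Proof.
move=> oU; elim: n F G => [|n IH] F G FG [cF].
all: have nFG x : U x -> \near x, F x = G x
  by move=> Ux; apply: filterS (open_nbhs_nbhs (conj oU Ux)) => y Uy;
     apply/FG/mem_set.
all: have cG x : U x -> {for x, continuous G}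
  by move=> Ux; rewrite /prop_for /continuous_at -FG ?inE//;
     apply: cvg_trans (cF x Ux); apply: near_eq_cvg;
     apply: filterS (nFG x Ux) => y ->.
- by [].
- move=> [dF DF]; split=> //; split=> [x v Ux|v].
    exact: near_eq_derivable (nFG x Ux) (dF x v Ux).
  apply: IH (DF v) => x /set_mem Ux.
  exact: near_eq_derive (nFG x Ux).
Unshelve. all: end_near. Qed.

Lemma smooth_germP V W (F : V -> W) :
  smooth_germ F <-> exists2 U, open_nbhs 0 U & forall n, Ck U n F.
Proof.
split=> [sF|[U oU cF]].
- exists (interior [set x : V | forall s : seq V,
    {for x, continuous (iter_dderive s F)} /\
    forall v : V, derivable (iter_dderive s F) x v]).
    by split; [exact: open_interior|exact: sF].
  set U := interior _.
  have : forall x, U x -> forall s : seq V,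
    {for x, continuous (iter_dderive s F)} /\
    forall v : V, derivable (iter_dderive s F) x v.
    by move=> x /interior_subset.
  move: U => U HU n; elim: n F HU {sF} => [|n IH] F HU.
    by split=> // x /HU /(_ [::]) [].
  split; first by move=> x /HU /(_ [::]) [].
  split=> [x v|v]; first by move=> /HU /(_ [::]) [_]; apply.
  (* [foldr] applies the last direction of the list first, so deriving ['D_v F] along [s] is
     deriving [F] along [rcons s v]. *)
  apply: IH => x /HU Hx s; have := Hx (rcons s v).
  by rewrite /iter_dderive foldr_rcons.
- have H s n : Ck U n (iter_dderive s F).
    by elim: s n => [|v s IH] n //=; apply/Ck_derive/IH.
  case: oU => oU U0; near=> x.
  have Ux : U x by near: x; exact: open_nbhs_nbhs.
  move=> s; split; first exact: Ck_continuous (H s 0) Ux.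
  by move=> v; exact: Ck_derivable (H s 1) Ux.
Unshelve. all: end_near. Qed.

End SmoothCalculus.

Section CkAlgebra.
Context {R : realType} {V : normedModType R}.
Implicit Types (U : set V) (F G : V -> R).

Lemma Ck_cst (W : normedModType R) U n (c : W) : Ck U n (fun _ : V => c).
Proof.
elim: n c => [|n IH] c; split=> //; try by move=> x _; exact: cvg_cst.
split=> [x v _|v]; first exact: derivable_cst.
rewrite (_ : 'D_v _ = fun=> 0); first exact: IH.
by apply/funext => x; rewrite derive_cst.
Qed.

Lemma CkD U n F G : open U -> Ck U n F -> Ck U n G -> Ck U n (fun x => F x + G x).
Proof.
move=> oU; elim: n F G => [|n IH] F G [cF dF] [cG dG]; split=> //.
- by move=> x Ux; apply: continuousD; [exact: cF|exact: cG].
- by move=> x Ux; apply: continuousD; [exact: cF|exact: cG].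
- move: dF dG => [dF DF] [dG DG]; split=> [x v Ux|v].
    by apply: derivableD; [exact: dF|exact: dG].
  apply: Ck_eq (IH _ _ (DF v) (DG v)) => // x /set_mem Ux.
  by rewrite /= deriveD//; [exact: dF|exact: dG].
Qed.

Lemma CkM U n F G : open U -> Ck U n F -> Ck U n G -> Ck U n (fun x => F x * G x).
Proof.
move=> oU; elim: n F G => [|n IH] F G CF CG.
  by split=> // x Ux; apply: continuousM;
    [exact: Ck_continuous CF Ux|exact: Ck_continuous CG Ux].
split; first by move=> x Ux; apply: continuousM;
    [exact: Ck_continuous CF Ux|exact: Ck_continuous CG Ux].
have [[_ [dF DF]] [_ [dG DG]]] := (CF, CG).
split=> [x v Ux|v]; first by apply: derivableM; [exact: dF|exact: dG].
apply: Ck_eq (CkD oU (IH _ _ (Ck_pred CF) (DG v)) (IH _ _ (Ck_pred CG) (DF v))) => //.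
move=> x /set_mem Ux.
by rewrite /= deriveM//; [exact: dF|exact: dG].
Qed.

Lemma Ck_sum U n (I : Type) (r : seq I) (F : I -> V -> R) : open U ->
  (forall i, Ck U n (F i)) -> Ck U n (fun x => \sum_(i <- r) F i x).
Proof.
move=> oU CF; elim: r => [|i r IH].
  by apply: Ck_eq (Ck_cst U n 0) => // x _; rewrite big_nil.
apply: Ck_eq (CkD oU (CF i) IH) => // x _.
by rewrite big_cons.
Qed.

End CkAlgebra.

Section CkMatrix.
Context {R : realType}.

Lemma Ck_mxP (V : normedModType R) (U : set V) n p q (F : V -> 'M[R]_(p, q)) :
  open U -> Ck U n F <-> forall i j, Ck U n (fun x => F x i j).
Proof.
move=> oU; split=> [|].
  elim: n F => [|n IH] F [cF dF] i j; split=> //.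
  - by move=> x Ux; apply: (@continuous_comp _ _ _ F (fun M => M i j : R));
      [exact: cF|exact: coord_continuous].
  - by move=> x Ux; apply: (@continuous_comp _ _ _ F (fun M => M i j : R));
      [exact: cF|exact: coord_continuous].
  - case: dF => dF DF; split=> [x v Ux|v].
      by have /derivable_mxP := dF x v Ux; apply.
    apply: Ck_eq (IH _ (DF v) i j) => // x /set_mem Ux.
    by rewrite derive_mx ?mxE//; exact: dF.
(* The matrix norm is a maximum over finitely many entries, so entrywise estimates hold
   simultaneously near [x]. *)
have cont (F' : V -> 'M[R]_(p, q)) :
    (forall i j x, U x -> {for x, continuous (fun x => F' x i j : R)}) ->
    forall x, U x -> {for x, continuous F'}.
  move=> cF x Ux; apply/cvgrPdist_le => /= e e0; near=> y.
  rewrite /Num.Def.normr/= mx_normrE (bigmax_le _ (ltW e0))//= => i _.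
  rewrite !mxE/=.
  move: i; near: y; apply: filter_forall => /= i.
  exact: ((cvgrPdist_le _ _).1 (cF i.1 i.2 x Ux)).
elim: n F => [|n IH] F CF.
  by split=> // x Ux; apply: cont Ux => i j y; exact: Ck_continuous (CF i j).
have dF x v : U x -> derivable F x v.
  by move=> Ux; apply/derivable_mxP => i j; exact: Ck_derivable (CF i j) Ux.
split; first by move=> x Ux; apply: cont Ux => i j y; exact: Ck_continuous (CF i j).
split=> // v; apply: IH => i j.
apply: Ck_eq (Ck_derive v (CF i j)) => // x /set_mem Ux.
by rewrite derive_mx ?mxE//; exact: dF.
Unshelve. all: end_near. Qed.

End CkMatrix.

(** * Fréchet differentiability from continuous partial derivatives *)

Section C1Differentiable.
Context {R : realType}.

Lemma ler_coord_norm m (u : 'rV[R]_m) i : `|u 0 i| <= `|u|.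
Proof.
rewrite [leRHS]/Num.Def.normr/= mx_normrE.
exact: (le_bigmax _ (fun ij => `|u ij.1 ij.2|) (0, i)).
Qed.

Lemma row_norm_le m (u : 'rV[R]_m) (e : R) : 0 <= e ->
  (forall i, `|u 0 i| <= e) -> `|u| <= e.
Proof.
move=> e0 ue; rewrite [leLHS]/Num.Def.normr/= mx_normrE.
by apply: bigmax_le => //= -[i j] _; rewrite ord1.
Qed.

Lemma is_derive_line (V W : normedModType R) (F : V -> W) (x v : V) (s : R) :
  derivable F (x + s *: v) v ->
  is_derive s (1 : R) (fun s => F (x + s *: v)) ('D_v F (x + s *: v)).
Proof.
have E : (fun h : R => h^-1 *: (((fun s => F (x + s *: v)) \o shift s) (h *: (1 : R)) -
    F (x + s *: v))) =
  (fun h => h^-1 *: ((F \o shift (x + s *: v)) (h *: v) - F (x + s *: v))).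
  apply/funext => h /=; congr (_ *: (F _ - _)).
  by rewrite addrCA -scalerDl [h *: (1 : R)]mulr1.
move=> dF; apply: DeriveDef; first by rewrite /derivable E; exact: dF.
by rewrite /derive E.
Qed.

(** Mean value theorem with a reference slope [l], for [b] of either sign. Later [l] is a partial
    derivative at a base point, or 0, and [e] bounds the deviation from it. *)
Lemma mvt_bound (g dg : R -> R) (b l e : R) :
  (forall s, `|s| <= `|b| -> is_derive s (1 : R) g (dg s) /\ `|dg s - l| <= e) ->
  `|g b - g 0 - b * l| <= e * `|b|.
Proof.
move=> H.
have key c d : c < d -> (forall s, c <= s <= d -> `|s| <= `|b|) ->
    `|g d - g c - (d - c) * l| <= e * (d - c).
  move=> cd cdb.
  have [||z zcd ->] := @MVT _ g dg c d cd.
  - move=> z; rewrite in_itv/= => /andP[cz zd].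
    by apply: (H z _).1; apply: cdb; rewrite !ltW.
  - apply: derivable_within_continuous => z; rewrite in_itv/= => /cdb.
    by move=> /H[].
  - rewrite [X in _ - X]mulrC -mulrBl normrM (gtr0_norm (x := d - c)) ?subr_gt0//.
    apply: ler_wpM2r; first by rewrite subr_ge0 ltW.
    move: zcd; rewrite in_itv/= => /andP[cz zd].
        by apply: (H z _).2; apply: cdb; rewrite !ltW.
have [b0|b0|->] := ltgtP b 0.
- have K : `|g 0 - g b - (0 - b) * l| <= e * (0 - b).
    apply: key => // s /andP[bs s0].
    by rewrite !ler0_norm ?lerN2 ?(ltW b0).
  rewrite (ltr0_norm b0) -(sub0r b) -normrN.
  by have <- : g 0 - g b - (0 - b) * l = - (g b - g 0 - b * l) by ring.
- have := key 0 b b0; rewrite !subr0 (gtr0_norm b0); apply=> s /andP[s0 sb].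
  by rewrite ger0_norm.
- by rewrite !subrr mul0r subr0 normr0 mulr0.
Qed.

(** One goes from [x] to [x + u] by changing one coordinate at a time; each leg is parallel to an
    axis, where [mvt_bound] applies. *)
Lemma telescope_bound m (F : 'rV[R]_m -> R) (x u : 'rV[R]_m) (l : 'I_m -> R)
    (e : R) :
  (forall z, `|z - x| <= `|u| -> forall k,
     derivable F z (delta_mx 0 k) /\ `|'D_(delta_mx 0 k) F z - l k| <= e) ->
  `|F (x + u) - F x - \sum_k u 0 k * l k| <= e * \sum_k `|u 0 k|.
Proof.
move=> H.
(* The corners [x + P j] of the broken line from [x] to [x + u]. *)
pose P j : 'rV[R]_m := \row_k (if (k < j)%N then u 0 k else 0).
suff : forall j, (j <= m)%N ->
    `|F (x + P j) - F x - \sum_(k < m | (k < j)%N) u 0 k * l k| <=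
    e * \sum_(k < m | (k < j)%N) `|u 0 k|.
  move=> /(_ m (leqnn m)).
  have -> : P m = u by apply/rowP => k; rewrite mxE ltn_ord.
  by under eq_bigl do rewrite ltn_ord; under [in leRHS]eq_bigl do rewrite ltn_ord.
elim=> [_|j IH jm].
  have -> : P 0 = 0 by apply/rowP => k; rewrite !mxE.
  by rewrite !big_pred0// addr0 subrr subr0 normr0 mulr0.
pose o := Ordinal jm.
have split_sum (a : 'I_m -> R) : \sum_(k < m | (k < j.+1)%N) a k =
    \sum_(k < m | (k < j)%N) a k + a o.
  rewrite (bigD1 o)//= addrC; congr (_ + _); apply: eq_bigl => k.
  by rewrite ltnS ltn_neqAle andbC -val_eqE.
have PS : P j.+1 = P j + u 0 o *: delta_mx 0 o.
  apply/rowP => k; rewrite !mxE eqxx/= -val_eqE/= ltnS leq_eqVlt.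
  case: eqVneq => [kj|_] /=; last by rewrite mulr0 addr0.
  by rewrite kj ltnn add0r mulr1; congr (u 0 _); apply/val_inj.
rewrite !split_sum mulrDr PS addrA.
have -> : F (x + P j + u 0 o *: delta_mx 0 o) - F x -
    (\sum_(k < m | (k < j)%N) u 0 k * l k + u 0 o * l o) =
  (F (x + P j) - F x - \sum_(k < m | (k < j)%N) u 0 k * l k) +
  (F (x + P j + u 0 o *: delta_mx 0 o) - F (x + P j) - u 0 o * l o) by ring.
apply: le_trans (ler_normD _ _) _; apply: lerD; first exact/IH/ltnW.
have := @mvt_bound (fun s => F (x + P j + s *: delta_mx 0 o))
  (fun s => 'D_(delta_mx 0 o) F (x + P j + s *: delta_mx 0 o)) (u 0 o) (l o) e.
rewrite scale0r addr0; apply=> s su.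
(* In the maximum norm every point of a leg is within [|u|] of [x]. *)
have [|d b] := H (x + P j + s *: delta_mx 0 o) _ o.
  rewrite -(addrA x) addrAC subrr add0r; apply: row_norm_le => // k.
  rewrite !mxE eqxx/=; case: ifPn => kj.
    rewrite -val_eqE/= (ltn_eqF kj) mulr0 addr0; exact: ler_coord_norm.
  rewrite add0r; case: eqP => [_|_]; last by rewrite mulr0 normr0.
  by rewrite mulr1 (le_trans su)// ler_coord_norm.
by split; [exact: is_derive_line|exact: b].
Qed.

(** Near [x] the partials oscillate little, and [telescope_bound] turns this into the [o(u)]
    estimate for the candidate differential [dF]. *)
Lemma C1_differentiable m (U : set 'rV[R]_m) (F : 'rV[R]_m -> R) x :
  open U -> Ck U 1 F -> U x -> differentiable F x.
Proof.
move=> oU CF Ux.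
pose dF (u : 'rV[R]_m) : R := \sum_k u 0 k * 'D_(delta_mx 0 k) F x.
have dF_lin : linear dF.
  move=> a u v; rewrite /dF scaler_sumr -big_split/=; apply: eq_bigr => k _.
  by rewrite !mxE mulrDl -scalerAl.
pose dFM := GRing.isLinear.Build _ _ _ _ dF dF_lin.
pose dFL : {linear 'rV[R]_m -> R} := HB.pack dF dFM.
have cdF : continuous dFL.
  move=> u; apply: (@Ck_continuous _ _ _ setT 0) => //.
  apply: Ck_sum => [|k]; first exact: openT.
  apply: CkM; [exact: openT| |exact: Ck_cst].
  by split=> // z _; exact: coord_continuous.
have E : F \o shift x = cst (F x) + dFL +o_ (0 : 'rV[R]_m) id.
  apply/eqaddoP => _/posnumP[e].
  (* The sum of the [m] coordinate sizes is at most [m |u|]; dividing by [m.+1] absorbs it and stays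
     meaningful for [m = 0]. *)
  have em0 : 0 < e%:num / m.+1%:R by rewrite divr_gt0.
  have : \forall z \near x, U z /\ forall k : 'I_m,
     `|'D_(delta_mx 0 k) F z - 'D_(delta_mx 0 k) F x| <= e%:num / m.+1%:R.
    near=> z; split; first by near: z; exact: open_nbhs_nbhs.
    near: z; apply: filter_forall => k.
    near=> z; rewrite distrC; near: z.
    have /cvgrPdist_le := Ck_continuous (Ck_derive (delta_mx 0 k) CF) Ux.
    exact.
  move=> /nbhs_normP[d/= d0 Hd].
  have nd : \forall u \near (0 : 'rV[R]_m), `|u| < d by exact: nbhs0_lt.
  near=> u.
  have ud : `|u| < d by near: u; exact: nd.
  have -> : (F \o shift x - (cst (F x) + dFL)) u =
     F (x + u) - F x - \sum_k u 0 k * 'D_(delta_mx 0 k) F x.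
    by rewrite /= !fctE /= /dF opprD addrA (addrC u x).
  apply: (@le_trans _ _ (e%:num / m.+1%:R * \sum_k `|u 0 k|)).
    apply: telescope_bound => z zu k.
    have [|Uz Dz] := Hd z; first by rewrite /= distrC (le_lt_trans zu).
    by split=> //; exact: Ck_derivable CF Uz.
  rewrite -mulrA ler_wpM2l// ler_pdivrMl//.
  apply: (@le_trans _ _ (\sum_(k < m) `|u|)).
    by apply: ler_sum => k _; exact: ler_coord_norm.
  rewrite sumr_const card_ord -[leLHS]mulr_natl.
  by apply: ler_wpM2r => //; rewrite ler_nat.
have D := diff_unique cdF E.
apply/diff_locallyP; split; rewrite D//.
Unshelve. all: end_near. Qed.

End C1Differentiable.

(** * Chain rule and smoothness of compositions *)

Section ChainRule.
Context {R : realType}.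

Lemma derive_rowE m (F : 'rV[R]_m -> R) x v : differentiable F x ->
  'D_v F x = \sum_k v 0 k * 'D_(delta_mx 0 k) F x.
Proof.
move=> dF; rewrite deriveE// {1}(row_sum_delta v) linear_sum.
by apply: eq_bigr => k _; rewrite linearZ/= -deriveE.
Qed.

Lemma derive_scalarE (F : R -> R) x v : derivable F x 1 ->
  'D_v F x = v * 'D_1 F x.
Proof.
move=> /derivable1_diffP dF; rewrite !deriveE//.
by rewrite -[v in LHS]mulr1 -[X in 'd F x X = _]/(v *: (1 : R)) linearZ.
Qed.

(** [phi] is only derivable along [v]. Restricting it to the line through [x] gives a function [p]
    of one variable, for which derivable means differentiable, and the usual chain rule applies to
    [F \o p]. *)
Lemma is_derive_comp (V M W : normedModType R) (F : M -> W) (phi : V -> M) x v :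
  differentiable F (phi x) -> derivable phi x v ->
  is_derive x v (fun y => F (phi y)) ('D_('D_v phi x) F (phi x)).
Proof.
move=> dF dphi.
pose p (s : R) := phi (x + s *: v).
have p0 : p 0 = phi x by rewrite /p scale0r addr0.
have [dp Dp] : is_derive (0 : R) (1 : R) p ('D_v phi x).
  have := @is_derive_line _ _ _ phi x v 0.
  by rewrite scale0r addr0; apply.
have {}dp : differentiable p 0 by exact/derivable1_diffP.
rewrite -p0 in dF.
have dFp : differentiable (F \o p) 0 by exact: differentiable_comp.
have E : (fun h : R => h^-1 *: (((F \o p) \o shift 0) (h *: (1 : R)) - (F \o p) 0)) =
  (fun h => h^-1 *: (((F \o phi) \o shift x) (h *: v) - F (phi x))).
  apply/funext => h /=; rewrite p0 /p addr0; congr (_ *: (F (phi _) - _)).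
  by rewrite [h *: (1 : R)]mulr1 addrC.
have D1 : derivable (F \o p) 0 (1 : R) by exact: diff_derivable.
apply: DeriveDef; first by move: D1; rewrite /derivable E.
have -> : 'D_v (fun y => F (phi y)) x = 'D_1 (F \o p) 0 by rewrite /derive E.
by rewrite deriveE// diff_comp//= -[in RHS]p0 deriveE// -Dp deriveE.
Qed.

(** The derivative of the composite is a sum of products of components of ['D_v phi] with partials
    of [F] composed with [phi]; the induction hypothesis applies to these partials. *)
Lemma Ck_comp (V : normedModType R) m (U : set V) (U' : set 'rV[R]_m) n
    (F : 'rV[R]_m -> R) (phi : V -> 'rV[R]_m) :
  open U -> open U' -> (forall x, U x -> U' (phi x)) ->
  Ck U' n F -> Ck U n phi -> Ck U n (fun x => F (phi x)).
Proof.
move=> oU oU' UU'.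
have cont (G : 'rV[R]_m -> R) k : Ck U' k G -> Ck U k phi ->
    forall x, U x -> {for x, continuous (fun x => G (phi x))}.
  move=> CG Cphi x Ux.
  apply: (@continuous_comp _ _ _ phi G); first exact: Ck_continuous Cphi Ux.
  exact: Ck_continuous CG (UU' _ Ux).
elim: n F => [|n IH] F CF Cphi; first by split=> //; exact: cont CF Cphi.
split; first exact: cont CF Cphi.
have D x v : U x ->
    is_derive x v (fun y => F (phi y)) ('D_('D_v phi x) F (phi x)).
  move=> Ux; apply: is_derive_comp; last exact: Ck_derivable Cphi Ux.
  by apply: (@C1_differentiable _ _ U'); [|apply: Ck_le CF|exact: UU'].
split=> [x v Ux|v]; first by have [] := D x v Ux.
pose D' x := \sum_k ('D_v phi x) 0 k * 'D_(delta_mx 0 k) F (phi x).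
apply: (@Ck_eq _ _ _ _ _ D') => //.
  move=> x /set_mem Ux; have [_ ->] := D x v Ux; rewrite derive_rowE//.
  by apply: (@C1_differentiable _ _ U'); [|apply: Ck_le CF|exact: UU'].
apply: Ck_sum => // k; apply: CkM => //.
  by have /(Ck_mxP _ _ oU) := Ck_derive v Cphi; apply.
by apply: (IH ('D_(delta_mx 0 k) F)); [exact: Ck_derive|exact: Ck_pred].
Qed.

(** [R] and ['rV[R]_1] are different types, so functions of one real variable, such as the
    components of the curve, get their own version. *)
Lemma Ck_comp1 (V : normedModType R) (U : set V) (U' : set R) n
    (F : R -> R) (phi : V -> R) :
  open U -> open U' -> (forall x, U x -> U' (phi x)) ->
  Ck U' n F -> Ck U n phi -> Ck U n (fun x => F (phi x)).
Proof.
move=> oU oU' UU'.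
have cont (G : R -> R) k : Ck U' k G -> Ck U k phi ->
    forall x, U x -> {for x, continuous (fun x => G (phi x))}.
  move=> CG Cphi x Ux.
  apply: (@continuous_comp _ _ _ phi G); first exact: Ck_continuous Cphi Ux.
  exact: Ck_continuous CG (UU' _ Ux).
elim: n F => [|n IH] F CF Cphi; first by split=> //; exact: cont CF Cphi.
split; first exact: cont CF Cphi.
have D x v : U x ->
    is_derive x v (fun y => F (phi y)) ('D_('D_v phi x) F (phi x)).
  move=> Ux; apply: is_derive_comp; last exact: Ck_derivable Cphi Ux.
  by apply/derivable1_diffP; apply: Ck_derivable CF (UU' _ Ux).
split=> [x v Ux|v]; first by have [] := D x v Ux.
apply: (@Ck_eq _ _ _ _ _ (fun x => 'D_v phi x * 'D_1 F (phi x))) => //.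
  move=> x /set_mem Ux; have [_ ->] := D x v Ux; rewrite [RHS]derive_scalarE//.
  by apply: Ck_derivable CF (UU' _ Ux).
apply: CkM => //; first exact: Ck_derive.
by apply: (IH ('D_1 F)); [exact: Ck_derive|exact: Ck_pred].
Qed.

End ChainRule.

(** * Hadamard's lemma *)

Section RadialIntegral.
Context {R : realType} {m : nat}.
Local Notation mu := (@lebesgue_measure R).
Implicit Types (g : 'rV[R]_m -> R) (x v : 'rV[R]_m) (r : R) (k n : nat).

(** Centred at 0 because the radial integrals use the whole segment from 0 to [x]. *)
Definition centered_ball r : set 'rV[R]_m := [set x | `|x| < r].

Lemma centered_ball_open r : open (centered_ball r).
Proof.
apply: (@open_comp _ _ (fun x : 'rV[R]_m => `|x|) [set y : R | y < r]).
  by move=> x _; exact: norm_continuous.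
exact: open_lt.
Qed.

Lemma scale_centered_ball r x (s : R) :
  0 <= s <= 1 -> centered_ball r x -> centered_ball r (s *: x).
Proof.
move=> /andP[s0 s1]; rewrite /centered_ball/= => xr.
by rewrite normrZ ger0_norm// (le_lt_trans _ xr)// ler_piMl.
Qed.

Lemma bounded_on_closed_ball g r : (forall z, `|z| <= r -> {for z, continuous g}) ->
  exists M, forall z, `|z| <= r -> `|g z| <= M.
Proof.
move=> cg; pose A := [set z : 'rV[R]_m | `|z| <= r].
have cA : compact A.
  apply: bounded_closed_compact.
    exists r; split; first exact: num_real.
    by move=> M rM z /= zr; rewrite (le_trans zr)// ltW.
  apply: (@closed_comp _ _ (fun x : 'rV[R]_m => `|x|) [set y : R | y <= r]).
    by move=> x _; exact: norm_continuous.
  exact: closed_le.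
have /compact_bounded : compact (g @` A).
  apply: continuous_compact => //; apply: continuous_in_subspaceT => z.
  by rewrite inE => /cg.
(* Boundedness is phrased by all numbers strictly above [M]. *)
move=> [M [_ HM]]; exists (M + 1) => z zr; apply: (HM (M + 1)).
  by rewrite ltrDl.
by exists z.
Qed.

(* The family is closed under differentiation: [D_v] maps the integral of
   index [k] of [g] to the one of index [k.+1] of ['D_v g]. *)
Definition radial_integral k g x : R :=
  (\int[mu]_(s in `[0%R, 1%R]) (s ^+ k * g (s *: x)))%R.

Lemma radial_integrable r k g x :
  (forall z, centered_ball r z -> {for z, continuous g}) -> centered_ball r x ->
  mu.-integrable `[0%R, 1%R] (EFin \o (fun s : R => s ^+ k * g (s *: x))).
Proof.
move=> cg rx; apply: continuous_compact_integrable; first exact: segment_compact.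
apply: continuous_in_subspaceT => s; rewrite inE/= in_itv/= => s01.
apply: (@continuousM R R^o (fun s : R => s ^+ k) (fun s : R => g (s *: x)) s).
  exact: exprn_continuous.
apply: (@continuous_comp _ _ _ (fun s : R => s *: x) g).
  exact: scalel_continuous.
exact/cg/scale_centered_ball.
Qed.

(** Dominated differentiation in the parameter [h] of [x + h *: v], at [h = 0]. The inner derivative
    of [s *: (x + h *: v)] supplies the extra factor [s]. *)
Lemma is_derive_radial_integral r k g x v : Ck (centered_ball r) 1 g ->
  centered_ball r x ->
  is_derive x v (radial_integral k g) (radial_integral k.+1 ('D_v g) x).
Proof.
move=> Cg rx.
(* The closed ball of radius [r'] is compact, lies in the open ball of radius [r] and contains a
   neighbourhood of [x]: there ['D_v g] has a bound, the dominating constant. *)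
pose r' := (`|x| + r) / 2.
have xr' : `|x| < r' by rewrite /r' ltr_pdivlMr// mulr_natr mulr2n ltrD2l.
have r'r : r' < r by rewrite /r' ltr_pdivrMr// mulr_natr mulr2n ltrD2r.
(* Chosen so that [|h| < d] keeps [x + h *: v] in the ball of radius [r']; the added 1 covers
   [v = 0]. *)
pose d := (r' - `|x|) / (`|v| + 1).
have v0 : 0 < `|v| + 1 by rewrite ltr_wpDl.
have d0 : 0 < d by rewrite divr_gt0// subr_gt0.
have near_x (h : R) : -d < h < d -> `|x + h *: v| <= r'.
  rewrite -ltr_norml => hd; apply: le_trans (ler_normD _ _) _.
  rewrite normrZ -lerBrDl.
  apply: (@le_trans _ _ (d * (`|v| + 1))).
    by apply: ler_pM => //; [exact: ltW|rewrite lerDl].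
  by rewrite /d divfK// gt_eqF.
have [M HM] : exists M, forall z, `|z| <= r' -> `|'D_v g z| <= M.
  apply: bounded_on_closed_ball => z zr; apply: Ck_continuous (Ck_derive v Cg) _.
  exact: le_lt_trans r'r.
have M0 : 0 <= M by apply: le_trans (HM 0 _) => //; rewrite normr0 (le_trans _ (ltW xr')).
pose f (h s : R) := s ^+ k * g (s *: (x + h *: v)).
have df h s : -d < h < d -> 0 <= s <= 1 ->
    is_derive h 1 (f ^~ s) (s ^+ k.+1 * 'D_v g (s *: (x + h *: v))).
  move=> hd s01.
  have rz : centered_ball r (s *: (x + h *: v)).
    by apply: scale_centered_ball => //; rewrite /centered_ball/= (le_lt_trans (near_x _ hd)).
  have dg : differentiable g (s *: (x + h *: v)).
    by apply: C1_differentiable Cg rz; exact: centered_ball_open.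
  have Df := @is_derive_line _ _ _ g (s *: x) (s *: v) h.
  have E : s *: x + h *: (s *: v) = s *: (x + h *: v).
    by rewrite scalerDr !scalerA (mulrC h).
  rewrite E in Df; have {}Df := Df (diff_derivable dg).
  have -> : f^~ s = (fun h => s ^+ k * g (s *: x + h *: (s *: v))).
    by apply/funext => h'; rewrite /f scalerDr !scalerA (mulrC h').
  have -> : s ^+ k.+1 * 'D_v g (s *: (x + h *: v)) =
      s ^+ k *: 'D_(s *: v) g (s *: (x + h *: v)).
    by rewrite !deriveE// linearZ/= exprSr -mulrA.
  exact: is_deriveZ.
have Icc s : `[0%R, 1%R]%classic s -> 0 <= s <= 1 by rewrite /= in_itv.
have Ioo (h : R) : `]-d, d[%classic h -> -d < h < d by rewrite /= in_itv.
have I0 : `]-d, d[%classic (0 : R) by rewrite /= in_itv/= oppr_lt0 d0.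
have intf h : `]-d, d[%classic h -> mu.-integrable `[0%R, 1%R] (EFin \o f h).
  move=> /Ioo/near_x hd; apply: (@radial_integrable r).
    by move=> z rz; exact: Ck_continuous Cg rz.
  exact: le_lt_trans r'r.
have H := @cvg_differentiation_under_integral R _ _ mu f `[0%R, 1%R]
  (measurable_itv _) 0 (-d) d I0 intf _ (cst M) _ _ _.
have {}H : h^-1 *: (\int[mu]_(y in `[0%R, 1%R]) f (h + 0) y -
      \int[mu]_(y in `[0%R, 1%R]) f 0 y) @[h --> 0^'] -->
    (radial_integral k.+1 ('D_v g) x : R).
  have -> : radial_integral k.+1 ('D_v g) x =
      \int[mu]_(y in `[0%R, 1%R]) partial1of2 f 0 y.
    apply: eq_Rintegral => s; rewrite inE => /Icc s01.
    rewrite partial1of2E; have [_ ->] := df 0 s (Ioo _ I0) s01.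
    by rewrite scale0r addr0.
  apply: H.
  - by move=> h s /Ioo hd /Icc s01; have [] := df h s hd s01.
  - by move=> s.
  - apply: continuous_compact_integrable; first exact: segment_compact.
    by apply: continuous_subspaceT => z; exact: cvg_cst.
  - move=> h s /Ioo hd /Icc s01; rewrite partial1of2E.
    have [_ ->] := df h s hd s01; rewrite normrM.
    move/andP: s01 => [s0 s1]; rewrite -[leRHS]mul1r; apply: ler_pM => //.
      by rewrite normrX ger0_norm// exprn_ile1.
    apply: HM; rewrite normrZ ger0_norm// -[leRHS]mul1r; apply: ler_pM => //.
    exact: near_x.
have E : (fun h : R => h^-1 *: (\int[mu]_(y in `[0%R, 1%R]) f (h + 0) y -
      \int[mu]_(y in `[0%R, 1%R]) f 0 y)) =
   (fun h : R => h^-1 *: ((radial_integral k g \o shift x) (h *: v) - radial_integral k g x)).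
  apply/funext => h; congr (_ *: (_ - _)); apply: eq_Rintegral => s _.
    by rewrite /f /= addr0 addrC.
  by rewrite /f scale0r addr0.
rewrite E in H.
by apply: DeriveDef; [apply/cvg_ex; eexists; exact: H|exact/cvg_lim].
Qed.

End RadialIntegral.

Section Hadamard.
Context {R : realType} {m : nat}.
Local Notation mu := (@lebesgue_measure R).
Implicit Types (g : 'rV[R]_m -> R) (x v : 'rV[R]_m) (r : R) (k n : nat).

(* Directional derivatives alone do not give continuity; a local bound on
   them does. *)
Lemma bounded_partials_continuous g x (d M : R) : 0 < d ->
  (forall z, `|z - x| < d -> forall k : 'I_m, derivable g z (delta_mx 0 k) /\
     `|'D_(delta_mx 0 k) g z| <= M) ->
  {for x, continuous g}.
Proof.
move=> d0 H; apply/(@cvgrPdist_le _ _ _ (nbhs x)) => /= e e0.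
pose M' := `|M| * m%:R + 1.
have M'0 : 0 < M' by rewrite ltr_wpDl.
have near_dist (c : R) : 0 < c -> \forall z \near x, `|z - x| < c.
  by move=> c0; apply/nbhs_normP; exists c => // z /=; rewrite distrC.
have nd := near_dist _ d0.
have ne := near_dist _ (divr_gt0 e0 M'0).
near=> z.
have zd : `|z - x| < d by near: z; exact: nd.
have ze : `|z - x| <= e / M' by apply: ltW; near: z; exact: ne.
have := @telescope_bound _ _ g x (z - x) (fun=> 0) `|M|.
rewrite big1 ?subr0; last by move=> k _; rewrite mulr0.
rewrite (addrC x) subrK => T; rewrite distrC; apply: le_trans (T _) _.
  move=> y yz k; have [|dg Dg] := H y _ k; first exact: le_lt_trans zd.
  by split=> //; rewrite subr0 (le_trans Dg)// ler_norm.
apply: (@le_trans _ _ (`|M| * (m%:R * `|z - x|))).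
  apply: ler_wpM2l => //; apply: (@le_trans _ _ (\sum_(k < m) `|z - x|)).
    by apply: ler_sum => k _; exact: ler_coord_norm.
  by rewrite sumr_const card_ord mulr_natl.
rewrite mulrA; apply: (@le_trans _ _ (M' * `|z - x|)).
  by apply: ler_wpM2r => //; rewrite lerDl.
by rewrite -ler_pdivlMl// mulrC.
Unshelve. all: end_near. Qed.

Lemma radial_integral_bound r k g (M : R) x :
  (forall z, centered_ball r z -> {for z, continuous g}) -> centered_ball r x ->
  (forall z, `|z| <= `|x| -> `|g z| <= M) ->
  `|radial_integral k g x| <= M.
Proof.
move=> cg rx gM; have I := @radial_integrable _ _ r k g x cg rx.
have mI : measurable (`[0%R, 1%R]%classic : set (measurableTypeR R)) by exact: measurable_itv.
apply: le_trans (le_normr_Rintegral mI I) _.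
have J : mu.-integrable `[0%R, 1%R] (EFin \o (fun s : R => M)).
  apply: continuous_compact_integrable; first exact: segment_compact.
  by apply: continuous_subspaceT => z; exact: cvg_cst.
apply: (@le_trans _ _ (\int[mu]_(s in `[0%R, 1%R]) M)%R).
  apply: le_Rintegral => //; first exact: (integrable_norm I).
  move=> s; rewrite /= in_itv/= => /andP[s0 s1].
  rewrite normrM -[leRHS]mul1r; apply: ler_pM => //.
    by rewrite normrX ger0_norm// exprn_ile1.
  by apply: gM; rewrite normrZ ger0_norm// ler_piMl.
rewrite Rintegral_cst// /= lebesgue_measure_itv/= lte_fin ltr01/=.
by rewrite subr0 mulr1.
Qed.

(** The partials of the integral are again radial integrals, bounded near [x] by the bounds of the
    partials of [g]. *)
Lemma radial_integral_continuous r k g x : Ck (centered_ball r) 1 g ->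
  centered_ball r x -> {for x, continuous (radial_integral k g)}.
Proof.
move=> Cg rx.
pose r' := (`|x| + r) / 2.
have xr' : `|x| < r' by rewrite /r' ltr_pdivlMr// mulr_natr mulr2n ltrD2l.
have r'r : r' < r by rewrite /r' ltr_pdivrMr// mulr_natr mulr2n ltrD2r.
have /choice[M HM] (i : 'I_m) : exists M, forall z, `|z| <= r' -> `|'D_(delta_mx 0 i) g z| <= M.
  apply: bounded_on_closed_ball => z zr; apply: Ck_continuous (Ck_derive _ Cg) _.
  exact: le_lt_trans r'r.
(* The sum is one bound valid for all the partials at once. *)
apply: (@bounded_partials_continuous _ _ (r' - `|x|) (\sum_i `|M i|)).
  by rewrite subr_gt0.
move=> z zx i.
have zr' : `|z| <= r'.
  rewrite -(subrK x z) (le_trans (ler_normD _ _))//.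
  by rewrite -lerBrDr ltW.
have zr : centered_ball r z by exact: le_lt_trans r'r.
have [dg ->] := is_derive_radial_integral k (delta_mx 0 i) Cg zr.
split; first exact: dg.
apply: (@le_trans _ _ (M i)).
  apply: (@radial_integral_bound r _ _ _ z _ zr).
    by move=> y yr; apply: Ck_continuous (Ck_derive _ Cg) yr.
  by move=> y yz; apply: HM; rewrite (le_trans yz).
rewrite (bigD1 i)//= (le_trans (ler_norm _))// lerDl.
by apply: sumr_ge0.
Qed.

(** One order is lost because continuity itself is deduced from bounded first derivatives; for
    smooth [g] this is harmless. *)
Lemma Ck_radial_integral r k n g : Ck (centered_ball r) n.+1 g ->
  Ck (centered_ball r) n (radial_integral k g).
Proof.
elim: n k g => [|n IH] k g Cg; split=> //.
- by move=> x; exact: radial_integral_continuous.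
- by move=> x; apply: radial_integral_continuous; exact: Ck_le Cg.
- have D x v : centered_ball r x -> is_derive x v (radial_integral k g)
      (radial_integral k.+1 ('D_v g) x).
    by apply: is_derive_radial_integral; exact: Ck_le Cg.
  split=> [x v rx|v]; first by have [] := D x v rx.
  apply: (@Ck_eq _ _ _ _ _ (radial_integral k.+1 ('D_v g))).
  + exact: centered_ball_open.
  + by move=> x /set_mem rx; have [_ ->] := D x v rx.
  + exact/IH/Ck_derive.
Qed.

(** Fundamental theorem of calculus on [[0, 1]] for [s |-> g (s *: x)], whose derivative is the sum
    of the [x_k] times the [k]-th partial of [g] at [s *: x]. *)
Lemma hadamard_centered_ball r g x : Ck (centered_ball r) 2 g ->
  centered_ball r x ->
  g x = g 0 + \sum_(k < m) x 0 k * radial_integral 0 ('D_(delta_mx 0 k) g) x.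
Proof.
move=> Cg rx.
pose F (s : R) := g (s *: x).
pose f (s : R) := \sum_(k < m) x 0 k * 'D_(delta_mx 0 k) g (s *: x).
have cDg (k : 'I_m) z : centered_ball r z -> {for z, continuous ('D_(delta_mx 0 k) g)}.
  by move=> rz; apply: Ck_continuous (Ck_derive _ Cg) rz.
have dF (s : R) : 0 <= s <= 1 -> is_derive s (1 : R) F (f s).
  move=> s01; have rsx : centered_ball r (s *: x) by exact: scale_centered_ball.
  have dg : differentiable g (s *: x).
    apply: C1_differentiable (@centered_ball_open _ _ r) _ rsx.
    exact: Ck_le Cg.
  have := @is_derive_line _ _ _ g 0 x s.
  rewrite add0r => /(_ (diff_derivable dg)).
  rewrite derive_rowE//; congr (is_derive _ _ _ _).
  by apply/funext => s'; rewrite add0r.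
have cF (s : R) : 0 <= s <= 1 -> {for s, continuous F}.
  by move=> /dF[dFs _]; exact/differentiable_continuous/derivable1_diffP.
have cfk (k : 'I_m) (s : R) : 0 <= s <= 1 ->
    {for s, continuous (fun s : R => x 0 k * 'D_(delta_mx 0 k) g (s *: x))}.
  move=> s01.
  apply: (@continuousM R R^o (fun s : R => x 0 k)
      (fun s : R => 'D_(delta_mx 0 k) g (s *: x)) s); first exact: cvg_cst.
  apply: (@continuous_comp _ _ _ (fun s : R => s *: x) ('D_(delta_mx 0 k) g)).
    exact: scalel_continuous.
  exact/cDg/scale_centered_ball.
(* Stated for any list of indices, as sum and integral are exchanged by induction on the enumeration
   and the tail must be integrable. *)
have cfs (I : seq 'I_m) (s : R) : 0 <= s <= 1 -> {for s, continuous (fun s : R =>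
    \sum_(k <- I) x 0 k * 'D_(delta_mx 0 k) g (s *: x))}.
  move=> s01; elim: I => [|k I IH].
    rewrite [X in {for s, continuous X}](_ : _ = fun=> 0); first exact: cvg_cst.
    by apply/funext => s'; rewrite big_nil.
  rewrite [X in {for s, continuous X}](_ : _ = fun s => x 0 k * 'D_(delta_mx 0 k) g (s *: x) +
    \sum_(k <- I) x 0 k * 'D_(delta_mx 0 k) g (s *: x)); last first.
    by apply/funext => s'; rewrite big_cons.
  by apply: (@continuousD R R^o R^o); [exact: cfk|exact: IH].
have int01 (h : R -> R) : (forall s : R, 0 <= s <= 1 -> {for s, continuous h}) ->
    mu.-integrable `[0%R, 1%R] (EFin \o h).
  move=> ch; apply: continuous_compact_integrable; first exact: segment_compact.
  by apply: continuous_in_subspaceT => s; rewrite inE/= in_itv/=; exact: ch.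
have mI : measurable (`[0%R, 1%R]%classic : set (measurableTypeR R)) by exact: measurable_itv.
have -> : \sum_(k < m) x 0 k * radial_integral 0 ('D_(delta_mx 0 k) g) x =
    (\int[mu]_(s in `[0%R, 1%R]) f s)%R.
  rewrite /f; elim: (index_enum _) => [|k I IH].
    rewrite big_nil; under eq_Rintegral do rewrite big_nil.
    by rewrite Rintegral_cst// mul0r.
  rewrite big_cons IH; under [RHS]eq_Rintegral do rewrite big_cons.
  rewrite RintegralD//; [|exact/int01/cfk|exact/int01/cfs].
  congr (_ + _).
  rewrite -[LHS](@RintegralZl _ _ _ mu _ _ (x 0 k) mI (radial_integrable 0 (cDg k) rx)).
  by apply: eq_Rintegral => s _; rewrite expr0 mul1r.
rewrite /Rintegral (@continuous_FTC2 _ f F 0 1 ltr01) /=.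
- by rewrite /F scale1r scale0r addrCA subrr addr0.
- by apply: continuous_in_subspaceT => s; rewrite inE/= in_itv/=; exact: cfs.
- split.
  + by move=> s; rewrite in_itv/= => /andP[s0 s1]; have [|] := dF s; rewrite ?(ltW s0) ?(ltW s1).
  + by apply: cvg_at_right_filter; apply: cF; rewrite lexx ler01.
  + by apply: cvg_at_left_filter; apply: cF; rewrite lexx ler01.
- move=> s; rewrite in_itv/= => /andP[s0 s1]; rewrite derive1E.
  by have [|_ ->] := dF s; rewrite ?(ltW s0) ?(ltW s1).
Qed.

End Hadamard.

(** * Smooth germs *)

Section SmoothGerms.
Context {R : realType}.
Implicit Types V W : normedModType R.

Lemma smooth_near_eq V W (F G : V -> W) : smooth_germ F ->
  (\forall x \near 0, F x = G x) -> smooth_germ G.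
Proof.
move=> /smooth_germP[U [oU U0] CF] FG; apply/smooth_germP.
exists (U `&` interior [set x | F x = G x]).
  split; first by apply: openI => //; exact: open_interior.
  by split=> //.
move=> n; apply: (@Ck_eq _ _ _ _ _ F).
- by apply: openI => //; exact: open_interior.
- by move=> x; rewrite inE => -[_ /interior_subset].
- by apply: Ck_subset (CF n) => x [].
Qed.

Lemma smooth_cst V (c : R) : smooth_germ (fun _ : V => c).
Proof.
apply/smooth_germP; exists setT; first by split=> //; exact: openT.
by move=> n; exact: Ck_cst.
Qed.

Lemma smoothD V (F G : V -> R) :
  smooth_germ F -> smooth_germ G -> smooth_germ (fun x => F x + G x).
Proof.
move=> /smooth_germP[U [oU U0] CF] /smooth_germP[U' [oU' U'0] CG].
apply/smooth_germP; exists (U `&` U'); first by split=> //; exact: openI.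
move=> n; apply: CkD; first exact: openI.
- by apply: Ck_subset (CF n) => x [].
- by apply: Ck_subset (CG n) => x [].
Qed.

Lemma smoothM V (F G : V -> R) :
  smooth_germ F -> smooth_germ G -> smooth_germ (fun x => F x * G x).
Proof.
move=> /smooth_germP[U [oU U0] CF] /smooth_germP[U' [oU' U'0] CG].
apply/smooth_germP; exists (U `&` U'); first by split=> //; exact: openI.
move=> n; apply: CkM; first exact: openI.
- by apply: Ck_subset (CF n) => x [].
- by apply: Ck_subset (CG n) => x [].
Qed.

Lemma smoothN V (F : V -> R) : smooth_germ F -> smooth_germ (fun x => - F x).
Proof.
move=> sF; apply: smooth_near_eq (smoothM (smooth_cst V (-1)) sF) _.
by apply: nearW => x; rewrite mulN1r.
Qed.

Lemma smoothB V (F G : V -> R) :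
  smooth_germ F -> smooth_germ G -> smooth_germ (fun x => F x - G x).
Proof. by move=> sF sG; exact: (smoothD sF (smoothN sG)). Qed.

Lemma smoothX V (F : V -> R) n : smooth_germ F -> smooth_germ (fun x => F x ^+ n).
Proof.
move=> sF; elim: n => [|n IH].
  by apply: smooth_near_eq (smooth_cst V 1) _; apply: nearW => x; rewrite expr0.
apply: smooth_near_eq (smoothM sF IH) _.
by apply: nearW => x; rewrite exprS.
Qed.

Lemma smooth_sum V (I : Type) (r : seq I) (F : I -> V -> R) :
  (forall i, smooth_germ (F i)) -> smooth_germ (fun x => \sum_(i <- r) F i x).
Proof.
move=> sF; elim: r => [|i r IH].
  by apply: smooth_near_eq (smooth_cst V 0) _; apply: nearW => x; rewrite big_nil.
apply: smooth_near_eq (smoothD (sF i) IH) _.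
by apply: nearW => x; rewrite big_cons.
Qed.

Lemma smooth_derive V W (F : V -> W) v : smooth_germ F -> smooth_germ ('D_v F).
Proof.
move=> /smooth_germP[U oU CF]; apply/smooth_germP; exists U => // n.
exact: Ck_derive.
Qed.

Lemma smooth_mxP V p q (F : V -> 'M[R]_(p, q)) :
  smooth_germ F <-> forall i j, smooth_germ (fun x => F x i j).
Proof.
split=> [/smooth_germP[U oU CF] i j|sF].
  apply/smooth_germP; exists U => // n.
  by have /Ck_mxP := CF n; apply; case: oU.
have {}sF (ij : 'I_p * 'I_q) : exists U : set V, open_nbhs 0 U /\
    forall n, Ck U n (fun x => F x ij.1 ij.2).
  by have /smooth_germP[U oU CF] := sF ij.1 ij.2; exists U.
have [U HU] := choice sF.
pose A := interior [set x | forall ij, U ij x].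
apply/smooth_germP; exists A.
  split; first exact: open_interior.
  apply: filter_forall => ij; apply: open_nbhs_nbhs.
  by have [] := HU ij.
move=> n; apply/Ck_mxP; first exact: open_interior.
move=> i j; apply: Ck_subset ((HU (i, j)).2 n).
by move=> x /interior_subset /(_ (i, j)).
Qed.

Lemma smooth_near_continuous V W (F : V -> W) : smooth_germ F ->
  \forall x \near 0, {for x, continuous F}.
Proof.
move=> /smooth_germP[U oU CF]; apply: filterS (open_nbhs_nbhs oU) => x.
exact: Ck_continuous (CF 0%N).
Qed.

Lemma smooth_near_derivable V W (F : V -> W) : smooth_germ F ->
  \forall x \near 0, forall v, derivable F x v.
Proof.
move=> /smooth_germP[U oU CF]; apply: filterS (open_nbhs_nbhs oU) => x Ux v.
exact: Ck_derivable (CF 1%N) Ux.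
Qed.

Lemma smooth_near_differentiable m (F : 'rV[R]_m -> R) : smooth_germ F ->
  \forall x \near 0, differentiable F x.
Proof.
move=> /smooth_germP[U oU CF]; apply: filterS (open_nbhs_nbhs oU) => x.
by apply: C1_differentiable (CF 1%N); case: oU.
Qed.

Lemma smooth_comp V m (F : 'rV[R]_m -> R) (phi : V -> 'rV[R]_m) :
  smooth_germ F -> smooth_germ phi -> phi 0 = 0 ->
  smooth_germ (fun x => F (phi x)).
Proof.
move=> /smooth_germP[U' [oU' U'0] CF] /smooth_germP[U [oU U0] Cphi] phi0.
apply/smooth_germP; exists (interior (U `&` phi @^-1` U')).
  split; first exact: open_interior.
  apply: filterI; first exact: open_nbhs_nbhs.
  have := Ck_continuous (Cphi 0%N) U0; apply.
  by rewrite phi0; exact: open_nbhs_nbhs.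
move=> n; apply: Ck_comp (oU') _ (CF n) _; first exact: open_interior.
  by move=> x /interior_subset[].
by apply: Ck_subset (Cphi n) => x /interior_subset[].
Qed.

Lemma smooth_comp1 V (F : R -> R) (phi : V -> R) :
  smooth_germ F -> smooth_germ phi -> phi 0 = 0 ->
  smooth_germ (fun x => F (phi x)).
Proof.
move=> /smooth_germP[U' [oU' U'0] CF] /smooth_germP[U [oU U0] Cphi] phi0.
apply/smooth_germP; exists (interior (U `&` phi @^-1` U')).
  split; first exact: open_interior.
  apply: filterI; first exact: open_nbhs_nbhs.
  have := Ck_continuous (Cphi 0%N) U0; apply.
  by rewrite phi0; exact: open_nbhs_nbhs.
move=> n; apply: Ck_comp1 (oU') _ (CF n) _; first exact: open_interior.
  by move=> x /interior_subset[].
by apply: Ck_subset (Cphi n) => x /interior_subset[].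
Qed.

Lemma hadamard m (g : 'rV[R]_m -> R) : smooth_germ g ->
  exists h : 'I_m -> 'rV[R]_m -> R, (forall k, smooth_germ (h k)) /\
    \forall x \near (0 : 'rV[R]_m), g x = g 0 + \sum_k x 0 k * h k x.
Proof.
move=> /smooth_germP[U [oU U0] Cg].
have /nbhs_normP[r /= r0 rU] : nbhs (0 : 'rV[R]_m) U by exact: open_nbhs_nbhs.
have {}Cg n : Ck (centered_ball r) n g.
  by apply: Ck_subset (Cg n) => x xr; apply: rU; rewrite /= sub0r normrN.
have oB : open_nbhs (0 : 'rV[R]_m) (centered_ball r).
  by split; [exact: centered_ball_open|rewrite /centered_ball/= normr0].
exists (fun k => radial_integral 0 ('D_(delta_mx 0 k) g)); split.
  move=> k; apply/smooth_germP; exists (centered_ball r) => // n.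
  exact/Ck_radial_integral/Ck_derive.
apply: filterS (open_nbhs_nbhs oB) => x xr.
exact: hadamard_centered_ball (Cg 2) xr.
Qed.

End SmoothGerms.

(** * Normal form of a quasi-homogeneous curve *)

Section CurveNormalForm.
Context {R : realType}.

Lemma near_smooth_comp (V W : normedModType R) (phi : V -> W) (P : W -> Prop) :
  smooth_germ phi -> phi 0 = 0 -> (\forall y \near 0, P y) ->
  \forall x \near 0, P (phi x).
Proof.
move=> /smooth_near_continuous/nbhs_singleton cphi phi0 nP.
by apply: cphi; rewrite /= phi0.
Qed.

(** This is what allows an identity known only near 0 to be differentiated at points near 0. *)
Lemma near_near (V : normedModType R) (P : V -> Prop) :
  (\forall x \near 0, P x) -> \forall x \near 0, \forall y \near x, P y.
Proof. by move=> /nbhs_interior. Qed.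

Lemma zero_derivative_constant (F : R -> R) : smooth_germ F ->
  (\forall s \near (0 : R), 'D_1 F s = 0) -> \forall s \near (0 : R), F s = F 0.
Proof.
move=> sF DF.
have /nbhs_normP[r /= r0 Hr] : \forall s \near (0 : R),
    (forall v, derivable F s v) /\ 'D_1 F s = 0.
  exact: filterI (smooth_near_derivable sF) DF.
apply/nbhs_normP; exists r => // b; rewrite /= sub0r normrN => br.
have := @mvt_bound _ F ('D_1 F) b 0 0.
rewrite mulr0 subr0 mul0r normr_le0 subr_eq0 => H; apply/eqP/H => s sb.
have [|dF DF0] := Hr s; first by rewrite /= sub0r normrN (le_lt_trans sb).
split; last by rewrite DF0 subr0 normr0.
by apply: DeriveDef.
Unshelve. all: end_near. Qed.

(** Differentiating [s F' = n F] gives [s F'' = (n - 1) F'], so by induction [F' = c s^(n-1)], and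
    the equation itself returns [F]. Smoothness at 0 forces the same constant on both sides of 0. *)
Lemma euler_ode_solution (F : R -> R) n : smooth_germ F ->
  (\forall s \near (0 : R), s * 'D_1 F s = n%:R * F s) ->
  exists c, \forall s \near (0 : R), F s = c * s ^+ n.
Proof.
have step (G : R -> R) k : smooth_germ G ->
    (\forall s \near (0 : R), s * 'D_1 G s = k%:R * G s) ->
    \forall s \near (0 : R), 'D_1 G s + s * 'D_1 ('D_1 G) s = k%:R * 'D_1 G s.
  move=> sG /near_near eqG.
  have dG : \forall s \near (0 : R), derivable G s 1 /\ derivable ('D_1 G) s 1.
    apply: filterS2 (smooth_near_derivable sG)
      (smooth_near_derivable (smooth_derive (1 : R) sG)) => s Gs G's.
    by split; [exact: Gs|exact: G's].
  near=> s; have [dGs dG's] : derivable G s 1 /\ derivable ('D_1 G) s 1.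
    by near: s; exact: dG.
  have -> : k%:R * 'D_1 G s = 'D_1 (fun s : R => k%:R * G s) s.
    by rewrite (deriveZ k%:R dGs).
  have <- : 'D_1 (fun s : R => s * 'D_1 G s) s = 'D_1 (fun s : R => k%:R * G s) s.
    by apply: near_eq_derive; near: s.
  have ds : derivable (@id R) s (1 : R) by exact: derivable_id.
  rewrite (deriveM ds dG's).
  by rewrite derive_id [RHS]addrC; congr (_ + _); rewrite [RHS]mulr1.
elim: n F => [|n IH] F sF eqF.
  exists (F 0).
  (* At [s = 0] the equation says nothing about [F']; the differentiated equation does. *)
  have F'0 : 'D_1 F 0 = 0.
    have := nbhs_singleton (step _ _ sF eqF).
    by rewrite !mul0r addr0.
  have := zero_derivative_constant sF; case.
    near=> s; have [->//|s0] := eqVneq s 0.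
    apply: (mulfI s0); rewrite mulr0.
    have -> : s * 'D_1 F s = 0%:R * F s by near: s.
    by rewrite mul0r.
  by move=> r r0 H; exists r => // s /H ->; rewrite expr0 mulr1.
have [|c Hc] := IH ('D_1 F) (smooth_derive (1 : R) sF).
  near=> s.
  have : 'D_1 F s + s * 'D_1 ('D_1 F) s = n.+1%:R * 'D_1 F s.
    by near: s; exact: step.
  by rewrite -natr1 mulrDl mul1r addrC => /addIr.
exists (c / n.+1%:R); near=> s.
have n0 : n.+1%:R != 0 :> R by rewrite pnatr_eq0.
apply: (mulfI n0); have <- : s * 'D_1 F s = n.+1%:R * F s by near: s.
have -> : 'D_1 F s = c * s ^+ n by near: s.
by rewrite exprS; field.
Unshelve. all: end_near. Qed.

Context {m : nat}.

Lemma derive_coord (x v : 'rV[R]_m) i : 'D_v (fun y : 'rV[R]_m => y 0 i) x = v 0 i.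
Proof.
have dx : derivable (@id 'rV[R]_m) x v by exact: derivable_id.
have /(congr1 (fun M : 'rV[R]_m => M 0 i)) := derive_mx dx.
by rewrite derive_id mxE.
Qed.

(** In the coordinate [s = tau t] the field [t d/dt] reads [s d/ds], and [chi] turns [E] into the
    diagonal linear field. Component [i] therefore solves the equation of [euler_ode_solution] with
    exponent [lambda i]. *)
Lemma quasi_homogeneous_monomial (f : R -> 'rV[R]_m) :
  curve_germ f -> quasi_homogeneous f ->
  exists (tau : R -> R) (chi psi : 'rV[R]_m -> 'rV[R]_m) (lambda : 'I_m -> nat)
    (c : 'I_m -> R),
  [/\ coordinates chi psi, (forall i, (0 < lambda i)%N) &
   forall i, \forall t \near (0 : R), chi (f t) 0 i = c i * tau t ^+ lambda i].
Proof.
move=> [sf f0] [tau [sigma [chi [psi [lambda [Ct Cc lam0 H]]]]]].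
exists tau, chi, psi, lambda.
suff key i : exists c, \forall t \near (0 : R), chi (f t) 0 i = c * tau t ^+ lambda i.
  by have [c Hc] := choice key; exists c.
have [stau ssigma tau0 sigma0 [sigmatau tausigma]] := Ct.
have [schi spsi chi0 psi0 [psichi chipsi]] := Cc.
have schii : smooth_germ (fun x => chi x 0 i) by exact: ((smooth_mxP chi).1 schi 0 i).
have sfsigma : smooth_germ (fun s => f (sigma s)).
  apply/smooth_mxP => a b.
  exact: (smooth_comp1 ((smooth_mxP f).1 sf a b) ssigma sigma0).
have fsigma0 : f (sigma 0) = 0 by rewrite sigma0.
have scfs : smooth_germ (fun s => chi (f (sigma s))).
  apply/smooth_mxP => a b.
  exact: (smooth_comp ((smooth_mxP chi).1 schi a b) sfsigma fsigma0).
have cfs0 : chi (f (sigma 0)) = 0 by rewrite fsigma0.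
pose F s := chi (f (sigma s)) 0 i.
have sF : smooth_germ F by exact: ((smooth_mxP _).1 scfs 0 i).
have [|c Hc] := @euler_ode_solution F (lambda i) sF; last first.
  exists c; near=> t.
  have {1}<- : sigma (tau t) = t by near: t.
  by near: t; exact: (near_smooth_comp stau tau0 Hc).
have nz : \forall s \near (0 : R), \forall y \near chi (f (sigma s)),
    chi (psi y) 0 i = y 0 i.
  have /near_near nz : \forall y \near (0 : 'rV[R]_m), chi (psi y) 0 i = y 0 i.
    by apply: filterS chipsi => y ->.
  exact: (near_smooth_comp scfs cfs0 nz).
near=> s.
have ts : tau (sigma s) = s by near: s.
have [dsigma dFs] : derivable sigma s s /\ derivable F s 1.
  near: s; apply: filterS2 (smooth_near_derivable ssigma)
    (smooth_near_derivable sF) => s sigmas Fs.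
  by split; [exact: sigmas|exact: Fs].
have df : differentiable f (sigma s).
  apply/derivable1_diffP; near: s.
  apply: (near_smooth_comp (P := fun t => derivable f t 1) ssigma sigma0).
  by apply: filterS (smooth_near_derivable sf) => s; exact.
(* The hypothesis at [t = sigma s]. Differentiating at the point [s] in the direction [s] realises
   [s d/ds]. *)
have Hs : 'D_('D_s sigma s) f (sigma s) =
    'D_(euler_field lambda (chi (f (sigma s)))) psi (chi (f (sigma s))).
  rewrite -{1}[in X in 'D_X sigma _]ts -{2}ts.
  by near: s; exact: (near_smooth_comp ssigma sigma0 H).
have dchi : differentiable (fun x => chi x 0 i) (f (sigma s)).
  near: s.
  apply: (near_smooth_comp (P := fun x => differentiable (fun x => chi x 0 i) x) sfsigma fsigma0).
  exact: smooth_near_differentiable.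
have dpsi v : derivable psi (chi (f (sigma s))) v.
  move: v; near: s.
  exact: (near_smooth_comp scfs cfs0 (smooth_near_derivable spsi)).
have pc : psi (chi (f (sigma s))) = f (sigma s).
  by near: s; exact: (near_smooth_comp sfsigma fsigma0 psichi).
have [dfs Dfs] := is_derive_comp df dsigma.
have [_ D1] := is_derive_comp dchi dfs.
rewrite Dfs Hs in D1.
pose z := chi (f (sigma s)).
have dchi' : differentiable (fun x => chi x 0 i) (psi z) by rewrite pc.
(* [D1] expresses ['D_s F s] as a derivative of the [i]-th chart coordinate along the push-forward
   by [psi] of the Euler field. It is also the derivative of that coordinate of [chi \o psi], near
   [z] a linear function, along the Euler field. *)
have [_] := is_derive_comp dchi' (dpsi (euler_field lambda z)).
rewrite pc -D1.
have -> : 'D_(euler_field lambda z) (fun y => chi (psi y) 0 i) z = (lambda i)%:R * F s.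
  transitivity ('D_(euler_field lambda z) (fun y : 'rV[R]_m => y 0 i) z).
    apply: near_eq_derive; rewrite /z; near: s.
    exact: nz.
  by rewrite derive_coord mxE.
by move=> ->; exact/esym/derive_scalarE.
Unshelve. all: end_near. Qed.

End CurveNormalForm.

(** * Forms with zero algebraic restriction *)

Section AlgebraicRestrictions.
Context {R : realType} {m : nat} (f : R -> 'rV[R]_m).
Implicit Types (p q h : 'rV[R]_m -> R) (u v b : 'I_m -> 'rV[R]_m -> R)
  (a : 'I_m -> 'I_m -> 'rV[R]_m -> R).

Local Notation e_ i := (delta_mx 0 i : 'rV[R]_m).

Lemma derive_mulE (V : normedModType R) (F G : V -> R) (x v : V) :
  derivable F x v -> derivable G x v ->
  'D_v (fun x => F x * G x) x = F x * 'D_v G x + G x * 'D_v F x.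
Proof. by move=> dF dG; exact: (deriveM dF dG). Qed.

Lemma derivable_exp (V : normedModType R) (F : V -> R) n (x v : V) :
  derivable F x v -> derivable (fun x => F x ^+ n) x v.
Proof. by move=> dF; have := @derivableX _ _ _ n _ _ dF; rewrite exprfctE. Qed.

Lemma derive_expE (V : normedModType R) (F : V -> R) n (x v : V) : derivable F x v ->
  'D_v (fun x => F x ^+ n) x = n%:R * F x ^+ n.-1 * 'D_v F x.
Proof. by move=> dF; have := deriveX n dF; rewrite exprfctE => ->. Qed.

Definition vanishes p := \forall t \near (0 : R), p (f t) = 0.

Lemma vanishes0 : vanishes (fun=> 0).
Proof. by rewrite /vanishes; near=> t. Unshelve. all: end_near. Qed.

Lemma vanishesM h p : vanishes p -> vanishes (fun x => h x * p x).
Proof. by apply: filterS => t ->; rewrite mulr0. Qed.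

Lemma vanishesD p q : vanishes p -> vanishes q -> vanishes (fun x => p x + q x).
Proof. by apply: filterS2 => t -> ->; rewrite addr0. Qed.

Lemma vanishesN p : vanishes p -> vanishes (fun x => - p x).
Proof. by apply: filterS => t ->; rewrite oppr0. Qed.

Definition ext_d1 b i j : 'rV[R]_m -> R :=
  fun x => 'D_(e_ i) (b j) x - 'D_(e_ j) (b i) x.

(* [a i j] is the coefficient of a 2-form on [(e_i, e_j)]: the form is
   [alpha + d (\sum_j b j dx_j)]. *)
Definition zero_restr a := exists (alpha : 'I_m -> 'I_m -> 'rV[R]_m -> R) b,
  [/\ forall i j, smooth_germ (alpha i j), forall i, smooth_germ (b i),
      forall i j, vanishes (alpha i j), forall i, vanishes (b i) &
      \forall x \near (0 : 'rV[R]_m), forall i j,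
        a i j x = alpha i j x + ext_d1 b i j x].

Lemma zero_restr_near_eq a a' : zero_restr a ->
  (\forall x \near (0 : 'rV[R]_m), forall i j, a i j x = a' i j x) -> zero_restr a'.
Proof.
move=> [al [b [sal sb val vb E]]] aa'; exists al, b; split=> //.
by apply: filterS2 E aa' => x E aa' i j; rewrite -aa' E.
Qed.

Lemma zero_restr_vanishes a : (forall i j, smooth_germ (a i j)) ->
  (forall i j, vanishes (a i j)) -> zero_restr a.
Proof.
move=> sa va; exists a, (fun=> fun=> 0); split=> //.
- by move=> _; exact: smooth_cst.
- by move=> _; exact: vanishes0.
- near=> x => i j.
  by rewrite /ext_d1 !(derive_cst (0 : R)) subrr addr0.
Unshelve. all: end_near. Qed.

Lemma near_derivable_all b : (forall i, smooth_germ (b i)) ->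
  \forall x \near (0 : 'rV[R]_m), forall i w, derivable (b i) x w.
Proof.
move=> sb; near=> x => i; move: i; near: x; apply: filter_forall => i.
exact: smooth_near_derivable (sb i).
Unshelve. all: end_near.
Qed.

Lemma zero_restrD a a' : zero_restr a -> zero_restr a' ->
  zero_restr (fun i j x => a i j x + a' i j x).
Proof.
move=> [al [b [sal sb val vb E]]] [al' [b' [sal' sb' val' vb' E']]].
exists (fun i j x => al i j x + al' i j x), (fun i x => b i x + b' i x); split.
- by move=> i j; exact: (smoothD (sal i j) (sal' i j)).
- by move=> i; exact: (smoothD (sb i) (sb' i)).
- by move=> i j; exact: vanishesD.
- by move=> i; exact: vanishesD.
have db : \forall x \near (0 : 'rV[R]_m),
    (forall k w, derivable (b k) x w) /\ forall k w, derivable (b' k) x w.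
  exact: filterI (near_derivable_all sb) (near_derivable_all sb').
near=> x => i j.
have -> : a i j x = al i j x + ext_d1 b i j x by move: i j; near: x.
have -> : a' i j x = al' i j x + ext_d1 b' i j x by move: i j; near: x.
have [dbx dbx'] : (forall k w, derivable (b k) x w) /\
    forall k w, derivable (b' k) x w by near: x; exact: db.
by rewrite /ext_d1 !(@deriveD _ _ _ (b _) (b' _))//; ring.
Unshelve. all: end_near. Qed.

(** [h (alpha + db) = (h alpha - dh /\ b) + d(h b)], and [dh /\ b] vanishes on the curve with
    [b]. *)
Lemma zero_restrM h a : smooth_germ h -> zero_restr a ->
  zero_restr (fun i j x => h x * a i j x).
Proof.
move=> sh [al [b [sal sb val vb E]]].
exists (fun i j x => h x * al i j x +
    ('D_(e_ j) h x * b i x - 'D_(e_ i) h x * b j x)), (fun i x => h x * b i x).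
split.
- move=> i j; apply: (smoothD (smoothM sh (sal i j))).
  exact: (smoothB (smoothM (smooth_derive _ sh) (sb i))
                  (smoothM (smooth_derive _ sh) (sb j))).
- by move=> i; exact: (smoothM sh (sb i)).
- move=> i j; apply: vanishesD; first exact: vanishesM.
  by apply: vanishesD; last apply: vanishesN; exact: vanishesM.
- by move=> i; exact: vanishesM.
have db := near_derivable_all sb; have dh := smooth_near_derivable sh.
near=> x => i j.
have -> : a i j x = al i j x + ext_d1 b i j x by move: i j; near: x.
have dbx k w : derivable (b k) x w by move: k w; near: x; exact: db.
have dhx w : derivable h x w by move: w; near: x; exact: dh.
by rewrite /ext_d1 !derive_mulE//; ring.
Unshelve. all: end_near. Qed.

Lemma zero_restrZ (c : R) a : zero_restr a -> zero_restr (fun i j x => c * a i j x).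
Proof. by apply: zero_restrM; exact: smooth_cst. Qed.

Lemma zero_restr_sum (I : Type) (r : seq I) (a : I -> 'I_m -> 'I_m -> 'rV[R]_m -> R) :
  (forall k, zero_restr (a k)) -> zero_restr (fun i j x => \sum_(k <- r) a k i j x).
Proof.
move=> ta; elim: r => [|k r IH].
  apply: (@zero_restr_near_eq (fun _ _ _ => 0)).
    by apply: zero_restr_vanishes => i j; [exact: smooth_cst|exact: vanishes0].
  by near=> x => i j; rewrite big_nil.
apply: (zero_restr_near_eq (zero_restrD (ta k) IH)).
by near=> x => i j; rewrite big_cons.
Unshelve. all: end_near. Qed.

Definition wedge u v i j : 'rV[R]_m -> R := fun x => u i x * v j x - u j x * v i x.
Definition partial p i : 'rV[R]_m -> R := 'D_(e_ i) p.

(** [dp /\ u = d(p u) - p du], where both [p u] and [p du] vanish on the curve. *)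
Lemma zero_restr_dwedge p u : smooth_germ p -> vanishes p ->
  (forall i, smooth_germ (u i)) -> zero_restr (wedge (partial p) u).
Proof.
move=> sp vp su.
exists (fun i j x => - ext_d1 u i j x * p x), (fun i x => u i x * p x); split.
- move=> i j; apply: (smoothM (smoothN _) sp).
  exact: (smoothB (smooth_derive _ (su j)) (smooth_derive _ (su i))).
- by move=> i; exact: (smoothM (su i) sp).
- by move=> i j; exact: vanishesM.
- by move=> i; exact: vanishesM.
have du := near_derivable_all su; have dp := smooth_near_derivable sp.
near=> x => i j.
have dux k w : derivable (u k) x w by move: k w; near: x; exact: du.
have dpx w : derivable p x w by move: w; near: x; exact: dp.
by rewrite /ext_d1 /wedge /partial !derive_mulE//; ring.
Unshelve. all: end_near. Qed.

End AlgebraicRestrictions.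

(** * Relations between differentials along a monomial curve *)

Section MonomialCurve.
Context {R : realType} {m : nat} (f : R -> 'rV[R]_m).
Context (y : 'I_m -> 'rV[R]_m -> R) (c : 'I_m -> R) (tau : R -> R)
  (lambda : 'I_m -> nat).
Hypothesis smooth_y : forall i, smooth_germ (y i).
Hypothesis lambda_gt0 : forall i, (0 < lambda i)%N.
Hypothesis y_curve : forall i, \forall t \near (0 : R),
  y i (f t) = c i * tau t ^+ lambda i.

Local Notation dy i := (partial (y i)).

Lemma vanishes_y i : c i = 0 -> vanishes f (y i).
Proof. by move=> ci0; apply: filterS (y_curve i) => t ->; rewrite ci0 mul0r. Qed.

Lemma smooth_partial (p : 'rV[R]_m -> R) i : smooth_germ p -> smooth_germ (partial p i).
Proof. exact: smooth_derive. Qed.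

Lemma smooth_wedge (u v : 'I_m -> 'rV[R]_m -> R) i j :
  (forall i, smooth_germ (u i)) -> (forall i, smooth_germ (v i)) ->
  smooth_germ (wedge u v i j).
Proof.
by move=> su sv; exact: (smoothB (smoothM (su i) (sv j)) (smoothM (su j) (sv i))).
Qed.

Lemma zero_restr_wedgeC (u v : 'I_m -> 'rV[R]_m -> R) :
  zero_restr f (wedge u v) -> zero_restr f (wedge v u).
Proof.
move=> /(zero_restrZ (-1)) H; apply: (zero_restr_near_eq H).
by near=> x => i j; rewrite /wedge; ring.
Unshelve. all: end_near. Qed.

Let relation o i : 'rV[R]_m -> R := fun x =>
  c i ^+ lambda o * y o x ^+ lambda i - c o ^+ lambda i * y i x ^+ lambda o.

Let smooth_relation o i : smooth_germ (relation o i).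
Proof.
exact: (smoothB (smoothM (smooth_cst _ _) (smoothX _ (smooth_y o)))
                (smoothM (smooth_cst _ _) (smoothX _ (smooth_y i)))).
Qed.

Let vanishes_relation o i : vanishes f (relation o i).
Proof.
apply: filterS2 (y_curve o) (y_curve i) => t Ho Hi.
by rewrite /relation Ho Hi !exprMn -!exprM mulnC; ring.
Qed.

Let d_relation o i : \forall x \near (0 : 'rV[R]_m), forall k,
  partial (relation o i) k x =
    c i ^+ lambda o * (lambda i)%:R * y o x ^+ (lambda i).-1 * dy o k x -
    c o ^+ lambda i * (lambda o)%:R * y i x ^+ (lambda o).-1 * dy i k x.
Proof.
have dery := near_derivable_all smooth_y.
near=> x => k.
have dyx l w : derivable (y l) x w by move: l w; near: x; exact: dery.
rewrite /partial /relation.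
have dX l n a : derivable (fun x => a * y l x ^+ n) x (delta_mx 0 k).
  apply: (@derivableM _ _ (fun=> a) (fun x => y l x ^+ n)); first exact: derivable_cst.
  exact: derivable_exp.
rewrite (@deriveB _ _ _ (fun x => c i ^+ lambda o * y o x ^+ lambda i)
  (fun x => c o ^+ lambda i * y i x ^+ lambda o))//.
have dE l n a : 'D_(delta_mx 0 k) (fun x => a * y l x ^+ n) x =
    a * n%:R * y l x ^+ n.-1 * 'D_(delta_mx 0 k) (y l) x.
  rewrite derive_mulE; last 2 first.
  - exact: derivable_cst.
  - exact: derivable_exp.
  by rewrite derive_expE// (derive_cst a) mulr0 addr0 !mulrA.
by rewrite !dE.
Unshelve. all: end_near. Qed.

Lemma zero_restr_pow_wedge o i j : c o != 0 ->
  zero_restr f (fun k l x =>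
    y o x ^+ (lambda i + lambda j) * wedge (dy i) (dy j) k l x).
Proof.
move=> co0.
have swdy : forall k l, smooth_germ (wedge (dy i) (dy j) k l).
  by move=> k l; apply: smooth_wedge => k'; exact: smooth_partial.
(* If [c i = 0] then [y i] vanishes on the curve and [dy_i /\ dy_j] is already zero. Otherwise [c i]
   may be divided by at the end; likewise for [j]. *)
have [ci0|ci0] := eqVneq (c i) 0.
  apply: zero_restrM; first exact: (smoothX _ (smooth_y o)).
  apply: zero_restr_dwedge; [exact: smooth_y|exact: vanishes_y|].
  by move=> k; exact: smooth_partial.
have [cj0|cj0] := eqVneq (c j) 0.
  apply: zero_restrM; first exact: (smoothX _ (smooth_y o)).
  apply: zero_restr_wedgeC; apply: zero_restr_dwedge; [exact: smooth_y|exact: vanishes_y|].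
  by move=> k; exact: smooth_partial.
pose A k : R := c k ^+ lambda o * (lambda k)%:R.
pose B k : R := c o ^+ lambda k * (lambda o)%:R.
have l0 : (lambda o)%:R != 0 :> R by rewrite pnatr_eq0 -lt0n.
have B0 k : B k != 0 by rewrite mulf_neq0// expf_neq0.
(* The multipliers in [T1] and [T2] are chosen so that the terms in [dy_o /\ dy_j] cancel in
   [T1 - T2], leaving only [dy_i /\ dy_j]. *)
have T1 : zero_restr f (wedge (partial (relation o j))
    (fun k x => A i * y o x ^+ (lambda i).-1 * dy o k x)).
  apply: zero_restr_dwedge; [exact: smooth_relation|exact: vanishes_relation|].
  move=> k.
  exact: (smoothM (smoothM (smooth_cst _ _) (smoothX _ (smooth_y o)))
    (smooth_partial _ (smooth_y o))).
have T2 : zero_restr f (wedge (partial (relation o i))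
    (fun k x => B j * y j x ^+ (lambda o).-1 * dy j k x)).
  apply: zero_restr_dwedge; [exact: smooth_relation|exact: vanishes_relation|].
  move=> k.
  exact: (smoothM (smoothM (smooth_cst _ _) (smoothX _ (smooth_y j)))
    (smooth_partial _ (smooth_y j))).
have T3 := zero_restrD T1 (zero_restrZ (-1) T2).
have T4 : zero_restr f (fun k l x => B i * B j *
    (y i x ^+ (lambda o).-1 * y j x ^+ (lambda o).-1) * wedge (dy i) (dy j) k l x).
  apply: (zero_restr_near_eq T3); near=> x => k l.
  have di : forall k, partial (relation o i) k x =
    A i * y o x ^+ (lambda i).-1 * dy o k x - B i * y i x ^+ (lambda o).-1 * dy i k x.
    by near: x; exact: d_relation.
  have dj : forall k, partial (relation o j) k x =
    A j * y o x ^+ (lambda j).-1 * dy o k x - B j * y j x ^+ (lambda o).-1 * dy j k x.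
    by near: x; exact: d_relation.
  rewrite /wedge !di !dj.
  move: (A i) (A j) (B i) (B j) (y i x ^+ _) (y j x ^+ _)
    (y o x ^+ (lambda i).-1) (y o x ^+ (lambda j).-1)
    (dy i k x) (dy i l x) (dy j k x) (dy j l x) (dy o k x) (dy o l x) => *.
  by ring.
(* Completes the exponents [lambda_o - 1] to [lambda_o], so that the coefficient can be compared
   with a power of [y_o] on the curve. *)
have T5 := zero_restrM (smoothM (smooth_y i) (smooth_y j)) T4.
pose Q x := (c i ^+ lambda o * c j ^+ lambda o) * y o x ^+ (lambda i + lambda j) -
  c o ^+ (lambda i + lambda j) * (y i x ^+ lambda o * y j x ^+ lambda o).
have sQ : smooth_germ Q.
  exact: (smoothB (smoothM (smooth_cst _ _) (smoothX _ (smooth_y o)))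
    (smoothM (smooth_cst _ _) (smoothM (smoothX _ (smooth_y i)) (smoothX _ (smooth_y j))))).
have vQ : vanishes f Q.
  near=> t; rewrite /Q.
  have -> : y o (f t) = c o * tau t ^+ lambda o by near: t; exact: y_curve.
  have -> : y i (f t) = c i * tau t ^+ lambda i by near: t; exact: y_curve.
  have -> : y j (f t) = c j * tau t ^+ lambda j by near: t; exact: y_curve.
  rewrite !exprMn -!exprM mulnDr !exprD (mulnC (lambda i)) (mulnC (lambda j)).
  by ring.
have T6 : zero_restr f (fun k l x => Q x * wedge (dy i) (dy j) k l x).
  apply: zero_restr_vanishes => k l; first exact: (smoothM sQ (swdy k l)).
  have := vanishesM (wedge (dy i) (dy j) k l) vQ.
  by apply: filterS => t; rewrite mulrC.
have C0 : c i ^+ lambda o * c j ^+ lambda o != 0 by rewrite mulf_neq0// expf_neq0.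
(* [K] makes [T5] cancel the second term of [Q]; only a nonzero constant times
   [y_o^(lambda_i+lambda_j)] remains. *)
pose K := c o ^+ (lambda i + lambda j) / (B i * B j).
have T7 := zero_restrZ (c i ^+ lambda o * c j ^+ lambda o)^-1 (zero_restrD T6 (zero_restrZ K T5)).
apply: (zero_restr_near_eq T7); near=> x => k l.
rewrite /Q /K -(prednK (lambda_gt0 o)) /= !exprS.
by field; rewrite !B0 ?(expf_neq0, ci0, cj0).
Unshelve. all: end_near. Qed.

Lemma zero_restr_y_pow_wedge : exists N, forall o i j,
  zero_restr f (fun k l x => y o x ^+ N * wedge (dy i) (dy j) k l x).
Proof.
(* Twice the sum dominates every [lambda_i + lambda_j]; the successor exposes a factor [y o], which
   settles the case [c o = 0]. *)
exists ((\sum_i lambda i).*2)%N.+1 => o i j.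
have [co0|co0] := eqVneq (c o) 0.
  apply: zero_restr_vanishes => k l.
    apply: (smoothM (smoothX _ (smooth_y o))).
    by apply: smooth_wedge => k'; exact: smooth_partial.
  apply: filterS (vanishes_y co0) => t ->.
  by rewrite exprS !mul0r.
have le k : (lambda k <= \sum_i lambda i)%N by rewrite (bigD1 k)//= leq_addr.
have lij : (lambda i + lambda j <= ((\sum_i lambda i).*2).+1)%N.
  by rewrite (leq_trans _ (leqnSn _))// -addnn leq_add.
have := zero_restrM (smoothX (((\sum_i lambda i).*2).+1 - (lambda i + lambda j))
  (smooth_y o)) (zero_restr_pow_wedge i j co0).
move/zero_restr_near_eq; apply; near=> x => k l.
by rewrite mulrA -exprD subnK.
Unshelve. all: end_near. Qed.

End MonomialCurve.

(** * Powers of the maximal ideal *)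

Section MaximalIdealPowers.
Context {R : realType} {m : nat} (y : 'I_m -> 'rV[R]_m -> R).
Hypothesis smooth_y : forall i, smooth_germ (y i).
Implicit Types (g h : 'rV[R]_m -> R).

(* Germs in the [n]-th power of the ideal generated by the [y_k]. *)
Fixpoint mpow n g : Prop :=
  if n is n'.+1 then
    exists h : 'I_m -> 'rV[R]_m -> R, (forall k, mpow n' (h k)) /\
      \forall x \near (0 : 'rV[R]_m), g x = \sum_k y k x * h k x
  else smooth_germ g.

Lemma mpowS n g : mpow n.+1 g ->
  exists h : 'I_m -> 'rV[R]_m -> R, (forall k, mpow n (h k)) /\
    \forall x \near (0 : 'rV[R]_m), g x = \sum_k y k x * h k x.
Proof. by []. Qed.

Lemma mpow_smooth n g : mpow n g -> smooth_germ g.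
Proof.
elim: n g => [//|n IH] g [h [Hh E]].
have S := smooth_sum (index_enum 'I_m) (fun k => smoothM (smooth_y k) (IH _ (Hh k))).
apply: (smooth_near_eq S); by apply: filterS E => x ->.
Qed.

Lemma mpow_near_eq n g g' : mpow n g ->
  (\forall x \near (0 : 'rV[R]_m), g x = g' x) -> mpow n g'.
Proof.
case: n => [|n]; first exact: smooth_near_eq.
move=> [h [Hh E]] E'; exists h; split=> //.
by apply: filterS2 E E' => x -> ->.
Qed.

Lemma mpow0 n : mpow n (fun=> 0).
Proof.
elim: n => [|n IH]; first exact: smooth_cst.
exists (fun=> fun=> 0); split=> //; near=> x.
by rewrite big1// => k _; rewrite mulr0.
Unshelve. all: end_near. Qed.

Lemma mpowD n g g' : mpow n g -> mpow n g' -> mpow n (fun x => g x + g' x).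
Proof.
elim: n g g' => [|n IH] g g'; first exact: smoothD.
move=> [h [Hh E]] [h' [Hh' E']]; exists (fun k x => h k x + h' k x).
split=> [k|]; first exact: (IH _ _ (Hh k) (Hh' k)).
apply: filterS2 E E' => x -> ->.
by rewrite -big_split; apply: eq_bigr => k _; rewrite mulrDr.
Qed.

Lemma mpowM n g g' : smooth_germ g -> mpow n g' -> mpow n (fun x => g x * g' x).
Proof.
move=> sg; elim: n g' => [|n IH] g'; first exact: smoothM.
move=> [h [Hh E]]; exists (fun k x => g x * h k x).
split=> [k|]; first exact: (IH _ (Hh k)).
apply: filterS E => x ->.
by rewrite mulr_sumr; apply: eq_bigr => k _; rewrite mulrCA.
Qed.

Lemma mpowMr n g g' : mpow n g -> smooth_germ g' -> mpow n (fun x => g x * g' x).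
Proof.
move=> Hg sg'; apply: mpow_near_eq (mpowM sg' Hg) _.
by near=> x; rewrite mulrC.
Unshelve. all: end_near. Qed.

Lemma mpow_sum n (I : Type) (r : seq I) (g : I -> 'rV[R]_m -> R) :
  (forall i, mpow n (g i)) -> mpow n (fun x => \sum_(i <- r) g i x).
Proof.
move=> Hg; elim: r => [|i r IH].
  by apply: mpow_near_eq (mpow0 n) _; near=> x; rewrite big_nil.
by apply: mpow_near_eq (mpowD (Hg i) IH) _; near=> x; rewrite big_cons.
Unshelve. all: end_near. Qed.

Lemma mpow_pred n g : mpow n.+1 g -> mpow n g.
Proof.
elim: n g => [|n IH] g Hg; first exact: mpow_smooth Hg.
have [h [Hh E]] := mpowS Hg; exists h; split=> // k; exact: (IH _ (Hh k)).
Qed.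

(** Leibniz rule on the sum of the [y_k h_k]: deriving [y_k] removes a factor, while the power lost
    in deriving [h_k] is restored by [y_k]. *)
Lemma mpow_derive n g v : mpow n.+1 g -> mpow n ('D_v g).
Proof.
elim: n g => [|n IH] g Hg; first exact/smooth_derive/(mpow_smooth Hg).
have [h [Hh E]] := mpowS Hg.
have H : mpow n.+1 (fun x => \sum_k 'D_v (y k) x * h k x + \sum_k y k x * 'D_v (h k) x).
  apply: mpowD.
    exact: (mpow_sum _ (fun k => mpowM (smooth_derive v (smooth_y k)) (Hh k))).
  exists (fun k => 'D_v (h k)); split=> [k|]; first exact: (IH _ (Hh k)).
  by near=> x.
apply: (mpow_near_eq H).
have dyh : \forall x \near (0 : 'rV[R]_m),
    (forall k w, derivable (y k) x w) /\ forall k w, derivable (h k) x w.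
  exact: filterI (near_derivable_all smooth_y)
    (near_derivable_all (fun k => mpow_smooth (Hh k))).
have E' := near_near E.
near=> x.
have [dyx dhx] : (forall k w, derivable (y k) x w) /\
    forall k w, derivable (h k) x w by near: x; exact: dyh.
have -> : 'D_v g x = 'D_v (fun x => \sum_k y k x * h k x) x.
  by apply: near_eq_derive; near: x.
have -> : (fun x => \sum_k y k x * h k x) = \sum_k (fun x => y k x * h k x).
  by apply/funext => z; rewrite fct_sumE.
rewrite derive_sum; last by move=> k; exact: (derivableM (dyx k v) (dhx k v)).
rewrite -big_split; apply: eq_bigr => k _ /=.
by rewrite derive_mulE//; ring.
Unshelve. all: end_near. Qed.

(** Hadamard's lemma in the coordinates [y]; [chart_division] provides it. *)
Hypothesis division : forall g, smooth_germ g ->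
  exists h : 'I_m -> 'rV[R]_m -> R, (forall k, smooth_germ (h k)) /\
    \forall x \near (0 : 'rV[R]_m), g x = g 0 + \sum_k y k x * h k x.

(** Taylor expansion by repeated division. The [e i] are the monomials of degree below [n], indexed
    by words in the variables, hence with repetitions: only spanning matters. *)
Lemma mpow_finite_codim n : exists (I : finType) (e : I -> 'rV[R]_m -> R),
  (forall i, smooth_germ (e i)) /\
  forall g, smooth_germ g ->
    exists c : I -> R, mpow n (fun x => g x - \sum_i c i * e i x).
Proof.
elim: n => [|n [I [e [se IH]]]].
  exists void, (fun=> fun=> 0); split=> [[]|g sg]; exists (fun=> 0).
  by apply: (smooth_near_eq sg); near=> x; rewrite big1 ?subr0// => -[].
exists (unit + 'I_m * I)%type,
  (fun s x => if s is inr ki then y ki.1 x * e ki.2 x else 1); split.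
  case=> [_|[k i]]; first exact: smooth_cst.
  exact: (smoothM (smooth_y k) (se i)).
move=> g /division[h [sh E]].
have [c Hc] := choice (fun k => IH (h k) (sh k)).
exists (fun s => if s is inr ki then c ki.1 ki.2 else g 0).
exists (fun k x => h k x - \sum_i c k i * e i x); split=> //.
apply: filterS E => x ->.
rewrite big_sumType/= big_const card_unit/=.
rewrite -(pair_bigA _ (fun k i => c k i * (y k x * e i x)))/= mulr1 addr0.
rewrite opprD addrACA subrr add0r -sumrB.
apply: eq_bigr => k _; rewrite mulrBr mulr_sumr; congr (_ - _).
by apply: eq_bigr => i _; rewrite mulrCA.
Unshelve. all: end_near. Qed.

End MaximalIdealPowers.

(** * Two-forms with coefficients in a high power of the maximal ideal *)

Section FlatForms.
Context {R : realType} {m : nat} (f : R -> 'rV[R]_m).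

Lemma smooth_prod (V : normedModType R) (I : Type) (r : seq I) (F : I -> V -> R) :
  (forall i, smooth_germ (F i)) -> smooth_germ (fun x => \prod_(i <- r) F i x).
Proof.
move=> sF; elim: r => [|i r IH].
  by apply: smooth_near_eq (smooth_cst V 1) _; apply: nearW => x; rewrite big_nil.
apply: smooth_near_eq (smoothM (sF i) IH) _.
by apply: nearW => x; rewrite big_cons.
Qed.

(* A monomial of degree above [m * N] in [m] variables is divisible by some
   [y o ^+ N]. *)
Lemma zero_restr_mpow (y : 'I_m -> 'rV[R]_m -> R) N n
    (w : 'I_m -> 'I_m -> 'rV[R]_m -> R) (h : 'rV[R]_m -> R) :
  (forall i, smooth_germ (y i)) ->
  (forall o, zero_restr f (fun k l x => y o x ^+ N * w k l x)) ->
  (m * N < n)%N -> mpow y n h ->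
  zero_restr f (fun k l x => h x * w k l x).
Proof.
move=> sy tw.
(* [a] is the monomial already extracted and [d] the power of the ideal still available; the total
   degree is preserved by the induction. *)
suff H d : forall a : 'I_m -> nat, (m * N < d + \sum_i a i)%N -> forall h, mpow y d h ->
    zero_restr f (fun k l x => (\prod_i y i x ^+ a i * h x) * w k l x).
  move=> mNn hh; have := H n (fun=> 0%N) _ h hh.
  rewrite big1// addn0 => /(_ mNn) /zero_restr_near_eq; apply; near=> x => k l.
  by rewrite big1 ?mul1r.
elim: d => [|d IH] a mN {}h hh.
  have [ o No] : exists o, (N <= a o)%N.
    apply: contrapT => /forallNP aN; move: mN; rewrite add0n ltnNge => /negP; apply.
    apply: (@leq_trans (\sum_(i < m) N)); last by rewrite sum_nat_const card_ord.
    by apply: leq_sum => i _; rewrite ltnW// ltnNge; apply/negP/aN.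
  have smq : smooth_germ (fun x => y o x ^+ (a o - N) *
      (\prod_(i | i != o) y i x ^+ a i) * h x).
    apply: (smoothM (smoothM (smoothX _ (sy o)) _) (mpow_smooth sy hh)).
    have sF i : smooth_germ (fun x => if i != o then y i x ^+ a i else 1).
      by case: (i != o); [exact: (smoothX _ (sy i))|exact: smooth_cst].
    apply: (smooth_near_eq (smooth_prod (index_enum 'I_m) sF)).
    by near=> x; rewrite [RHS]big_mkcond.
  have := zero_restrM smq (tw o); move/zero_restr_near_eq; apply; near=> x => k l.
  rewrite [in RHS](bigD1 o)//= -[in RHS](subnK No) exprD; ring.
(* One factor [y p] passes from the ideal to the monomial, so [a p] grows by one as [d] drops by
   one. *)
have [g [Hg E]] := mpowS hh.
have T (p : 'I_m) : zero_restr f (fun k l x =>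
    (\prod_i y i x ^+ (a i + (i == p)) * g p x) * w k l x).
  apply: (IH (fun i => a i + (i == p))%N) (Hg p).
  have s1 : (\sum_(i < m) (i == p) = 1)%N.
    by rewrite (bigD1 p)//= eqxx big1// => i /negPf ->.
  by rewrite big_split/= s1 addn1 addnS -addSn.
have := zero_restr_sum (index_enum 'I_m) T; move/zero_restr_near_eq; apply.
near=> x => k l.
have -> : h x = \sum_p y p x * g p x by near: x.
rewrite -mulr_suml mulr_sumr; congr (_ * _); apply: eq_bigr => p _.
rewrite [in LHS](bigD1 p)//= eqxx addn1 exprS.
under eq_bigr => i /negPf -> do rewrite addn0.
by rewrite [in RHS](bigD1 p)//=; ring.
Unshelve. all: end_near. Qed.

Section Chart.
Context (chi psi : 'rV[R]_m -> 'rV[R]_m).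
Hypothesis chart : coordinates chi psi.

Let y i x := chi x 0 i.

Lemma smooth_chart_coord i : smooth_germ (y i).
Proof. by case: chart => schi _ _ _ _; exact: ((smooth_mxP chi).1 schi 0 i). Qed.

(** Hadamard's lemma for [g \o psi], pulled back by [chi]. *)
Lemma chart_division g : smooth_germ g ->
  exists h : 'I_m -> 'rV[R]_m -> R, (forall k, smooth_germ (h k)) /\
    \forall x \near (0 : 'rV[R]_m), g x = g 0 + \sum_k y k x * h k x.
Proof.
move=> sg; case: chart => schi spsi chi0 psi0 [psichi _].
have [h [sh E]] := hadamard (smooth_comp sg spsi psi0).
exists (fun k x => h k (chi x)); split=> [k|].
  exact: (smooth_comp (sh k) schi chi0).
have E' := near_smooth_comp schi chi0 E.
near=> x.
have pc : psi (chi x) = x by near: x.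
rewrite -{1}pc -{1}psi0; near: x; exact: E'.
Unshelve. all: end_near. Qed.

(* [dx_p = \sum_k (d_k psi_p \o chi) dy_k] *)
Lemma chart_codifferential : exists g : 'I_m -> 'I_m -> 'rV[R]_m -> R,
  (forall p k, smooth_germ (g p k)) /\
  \forall x \near (0 : 'rV[R]_m), forall p i,
    (i == p)%:R = \sum_k g p k x * partial (y k) i x.
Proof.
case: chart => schi spsi chi0 psi0 [psichi _].
have spsip p : smooth_germ (fun z => psi z 0 p) by exact: ((smooth_mxP psi).1 spsi 0 p).
exists (fun p k x => 'D_(delta_mx 0 k) (fun z => psi z 0 p) (chi x)); split.
  move=> p k; exact: (smooth_comp (smooth_derive _ (spsip p)) schi chi0).
have E := near_near psichi.
have dchi := smooth_near_derivable schi.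
have dpsi0 : \forall x \near (0 : 'rV[R]_m), forall p, differentiable (fun z => psi z 0 p) x.
  near=> x => p; move: p; near: x; apply: filter_forall => p.
  exact: smooth_near_differentiable (spsip p).
have dpsic := near_smooth_comp schi chi0 dpsi0.
near=> x => p i.
have dpsi : differentiable (fun z => psi z 0 p) (chi x).
  by move: p; near: x.
have dchix v : derivable chi x v by move: v; near: x; exact: dchi.
have [_ D] := is_derive_comp dpsi (dchix (delta_mx 0 i)).
have -> : (i == p)%:R = 'D_(delta_mx 0 i) (fun x => psi (chi x) 0 p) x.
  rewrite (_ : 'D_(delta_mx 0 i) _ x = 'D_(delta_mx 0 i) (fun x : 'rV[R]_m => x 0 p) x).
    by rewrite derive_coord mxE eqxx/= eq_sym.
  apply: near_eq_derive.
  have : \forall y \near x, psi (chi y) = y by near: x.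
  by apply: filterS => z ->.
rewrite D derive_rowE//; apply: eq_bigr => k _.
by rewrite mulrC; congr (_ * _); rewrite derive_mx ?mxE.
Unshelve. all: end_near. Qed.

(** The form is half the sum of [a p q dx_p /\ dx_q] over ordered pairs, each unordered pair being
    met twice. Writing [dx_p] in the [dy_k] makes it a combination of the [dy_k /\ dy_l] with
    coefficients in the same power of the ideal. *)
Lemma zero_restr_flat N n (a : 'I_m -> 'I_m -> 'rV[R]_m -> R) :
  (forall o i j, zero_restr f (fun k l x =>
     y o x ^+ N * wedge (partial (y i)) (partial (y j)) k l x)) ->
  (m * N < n)%N -> (forall i j, mpow y n (a i j)) ->
  (\forall x \near (0 : 'rV[R]_m), forall i j, a i j x = - a j i x) ->
  zero_restr f a.
Proof.
move=> tw mNn Ha anti.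
have [g [sg E]] := chart_codifferential.
have T (s : ('I_m * 'I_m) * ('I_m * 'I_m)) : zero_restr f (fun i j x =>
    (2^-1 * (g s.1.1 s.2.1 x * g s.1.2 s.2.2 x) * a s.1.1 s.1.2 x) *
    wedge (partial (y s.2.1)) (partial (y s.2.2)) i j x).
  apply: (zero_restr_mpow smooth_chart_coord _ mNn).
    by move=> o; exact: tw.
  exact: (mpowM (smoothM (smooth_cst _ _) (smoothM (sg _ _) (sg _ _))) (Ha _ _)).
have := zero_restr_sum (index_enum _) T; move/zero_restr_near_eq; apply.
near=> x => i j.
have Ex p i' : (i' == p)%:R = \sum_k g p k x * partial (y k) i' x by move: p i'; near: x.
have ax : a i j x = - a j i x by move: i j; near: x.
(* Both sides are [dx_p /\ dx_q] evaluated on [(e_i, e_j)]. *)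
have W p q : \sum_kl g p kl.1 x * g q kl.2 x * wedge (partial (y kl.1)) (partial (y kl.2)) i j x =
    (i == p)%:R * (j == q)%:R - (j == p)%:R * (i == q)%:R.
  rewrite !Ex -(pair_bigA _ (fun k l => g p k x * g q l x *
    wedge (partial (y k)) (partial (y l)) i j x))/=.
  rewrite !big_distrl/= -sumrB; apply: eq_bigr => k _.
  rewrite !big_distrr/= -sumrB; apply: eq_bigr => l _.
  by rewrite /wedge; ring.
rewrite -(pair_bigA _ (fun pq kl => 2^-1 * (g pq.1 kl.1 x * g pq.2 kl.2 x) * a pq.1 pq.2 x *
    wedge (partial (y kl.1)) (partial (y kl.2)) i j x))/=.
transitivity (\sum_p \sum_q 2^-1 * a p q x *
    ((i == p)%:R * (j == q)%:R - (j == p)%:R * (i == q)%:R)).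
  rewrite [RHS]pair_bigA/=; apply: eq_bigr => -[p q] _ /=; rewrite -W mulr_sumr.
  by apply: eq_bigr => kl _; ring.
have S i' j' : \sum_p \sum_q 2^-1 * a p q x * ((i' == p)%:R * (j' == q)%:R) = 2^-1 * a i' j' x.
  rewrite (bigD1 i')//= [X in _ + X]big1 ?addr0; last first.
    move=> p pi; rewrite big1// => q _.
    by rewrite eq_sym (negPf pi) mul0r mulr0.
  rewrite (bigD1 j')//= [X in _ + X]big1 ?addr0; last first.
    by move=> q qj; rewrite [j' == q]eq_sym (negPf qj) !mulr0.
  by rewrite !eqxx !mulr1.
transitivity (2^-1 * a i j x - 2^-1 * a j i x).
  rewrite -!S -sumrB; apply: eq_bigr => p _; rewrite -sumrB; apply: eq_bigr => q _.
  by rewrite mulrBr.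
by rewrite [in RHS]ax; have := ax; lra.
Unshelve. all: end_near. Qed.

End Chart.
End FlatForms.

(** * Lie derivatives of 2-forms *)

Section Forms.
Context {R : realType} {m : nat}.
Implicit Types (X : 'rV[R]_m -> 'rV[R]_m).

Definition set_row k (V : 'M[R]_(k, m)) i (u : 'rV[R]_m) : 'M[R]_(k, m) :=
  \matrix_(r, l) if r == i then u 0 l else V r l.

Lemma row_set_row k (V : 'M[R]_(k, m)) i u : row i (set_row V i u) = u.
Proof. by apply/rowP => l; rewrite !mxE eqxx. Qed.

Lemma row'_set_row k (V : 'M[R]_(k, m)) i u u' :
  row' i (set_row V i u) = row' i (set_row V i u').
Proof. by apply/matrixP => r l; rewrite !mxE eq_sym (negPf (neq_lift i r)). Qed.

Lemma set_row_row k (V : 'M[R]_(k, m)) i : set_row V i (row i V) = V.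
Proof. by apply/matrixP => r l; rewrite !mxE; case: eqP => [->|]. Qed.

Lemma multilinear_set_row k (w : 'M[R]_(k, m) -> R) V i :
  alternating_multilinear w -> linear (fun u => w (set_row V i u)).
Proof.
move=> [wl _] a u v.
rewrite (wl _ (set_row V i u) (set_row V i v) i a 1) ?mul1r//.
- by rewrite !row_set_row scale1r.
- exact: row'_set_row.
- exact: row'_set_row.
Qed.

Lemma multilinear_row k (w : 'M[R]_(k, m) -> R) V i : alternating_multilinear w ->
  w V = \sum_j V i j * w (set_row V i (delta_mx 0 j)).
Proof.
move=> wam; have wl := multilinear_set_row V i wam.
pose wM := GRing.isLinear.Build _ _ _ _ (fun u => w (set_row V i u)) wl.
pose wL : {linear 'rV[R]_m -> R} := HB.pack (fun u => w (set_row V i u)) wM.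
rewrite -[in LHS](set_row_row V i) -[LHS]/(wL (row i V)) [row i V]row_sum_delta linear_sum.
by apply: eq_bigr => j _; rewrite linearZ/= mxE.
Qed.

Definition pair2 (i j : 'I_m) (r : 'I_2) : 'I_m := if r == 0 then i else j.

Lemma set_row_pair2 (V : 'M[R]_(2, m)) i j :
  set_row (set_row V 0 (delta_mx 0 i)) 1 (delta_mx 0 j) = rowsub (pair2 i j) 1%:M.
Proof.
apply/matrixP => r l; rewrite !mxE /pair2 eqxx /=.
by case: r => [[|[|//]] r2] /=; rewrite eq_sym.
Qed.

Lemma bilinear_expansion (w : 'M[R]_(2, m) -> R) V : alternating_multilinear w ->
  w V = \sum_i \sum_j V 0 i * V 1 j * w (rowsub (pair2 i j) 1%:M).
Proof.
move=> wam; rewrite (multilinear_row V 0 wam); apply: eq_bigr => i _.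
rewrite (multilinear_row _ 1 wam) mulr_sumr; apply: eq_bigr => j _.
by rewrite set_row_pair2 mulrA mxE.
Qed.

(** Polarisation of [w (u + v, u + v) = 0]. *)
Lemma alternating_coefC (w : 'M[R]_(2, m) -> R) i j : alternating_multilinear w ->
  w (rowsub (pair2 i j) 1%:M) = - w (rowsub (pair2 j i) 1%:M).
Proof.
move=> wam; pose M (u v : 'rV[R]_m) : 'M[R]_(2, m) := set_row (set_row 0 0 u) 1 v.
have M0 u v : row 0 (M u v) = u by apply/rowP => l; rewrite !mxE.
have M1 u v : row 1 (M u v) = v by apply/rowP => l; rewrite !mxE.
have wMM u : w (M u u) = 0 by apply: (wam.2 _ 0 1) => //; rewrite M0 M1.
have wMl u u' v : w (M (u + u') v) = w (M u v) + w (M u' v).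
  rewrite -[w (M u v)]mul1r -[w (M u' v)]mul1r.
  apply: (wam.1 _ _ _ 0); rewrite ?M0 ?scale1r//;
    by apply/matrixP => r l; rewrite !mxE; case: r => [[|//] ?].
have wMr u v v' : w (M u (v + v')) = w (M u v) + w (M u v').
  rewrite -[w (M u v)]mul1r -[w (M u v')]mul1r.
  apply: (wam.1 _ _ _ 1); rewrite ?M1 ?scale1r//;
    by apply/matrixP => r l; rewrite !mxE; case: r => [[|//] ?].
rewrite -!(set_row_pair2 0) -/(M (delta_mx 0 i) (delta_mx 0 j))
  -/(M (delta_mx 0 j) (delta_mx 0 i)).
have := wMM (delta_mx 0 i + delta_mx 0 j).
rewrite wMl !wMr !wMM addr0 add0r => /eqP; rewrite addr_eq0 => /eqP //.
Qed.

Lemma sum_ord2 (F : 'I_2 -> R) : \sum_i F i = F 0 + F 1.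
Proof.
rewrite big_ord_recl big_ord_recl big_ord0 addr0.
by congr (_ + F _); apply/val_inj.
Qed.

Definition coef2 (w : @Defs.form R m 2) i j := form_coef w (pair2 i j).

Lemma derive_lincomb (I : Type) (r : seq I) (c : I -> R)
    (W : I -> 'rV[R]_m -> R) x v : (forall i, derivable (W i) x v) ->
  derivable (fun z => \sum_(i <- r) c i * W i z) x v /\
  'D_v (fun z => \sum_(i <- r) c i * W i z) x = \sum_(i <- r) c i * 'D_v (W i) x.
Proof.
move=> dW; elim: r => [|i r [IH1 IH2]].
  have -> : (fun z => \sum_(i <- [::]) c i * W i z) = (fun=> 0).
    by apply/funext => z; rewrite big_nil.
  by rewrite big_nil; split; [exact: derivable_cst|exact: (derive_cst (0 : R))].
have -> : (fun z => \sum_(k <- i :: r) c k * W k z) =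
    (fun z => c i *: W i z) + (fun z => \sum_(k <- r) c k * W k z).
  by apply/funext => z; rewrite big_cons.
have dZ : derivable (fun z => c i *: W i z) x v
  by exact: (@derivableZ _ _ _ (W i) (c i) x v (dW i)).
split; first exact: (derivableD dZ IH1).
by rewrite (deriveD dZ IH1) big_cons IH2; congr (_ + _); exact: (deriveZ (c i) (dW i)).
Qed.

(** Classical coordinate formula for [(L_X w)(e_i, e_j)]. Each term contains [X] linearly and at
    most one derivative of it. *)
Definition lie_coef X (W : 'I_m -> 'I_m -> 'rV[R]_m -> R) i j : 'rV[R]_m -> R :=
  fun x => \sum_k (X x 0 k * partial (W i j) k x +
    (partial (fun x => X x 0 k) i x * W k j x + partial (fun x => X x 0 k) j x * W i k x)).

Lemma smooth_coef2 (w : @Defs.form R m 2) i j : form_germ w -> smooth_germ (coef2 w i j).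
Proof. by case=> _; apply. Qed.

Lemma near_coef2C (w : @Defs.form R m 2) : form_germ w ->
  \forall x \near (0 : 'rV[R]_m), forall i j, coef2 w i j x = - coef2 w j i x.
Proof.
by move=> [am _]; apply: filterS am => x wx i j; exact: alternating_coefC.
Qed.

Lemma lie_derivative_expansion X (w : @Defs.form R m 2) : smooth_germ X -> form_germ w ->
  \forall x \near (0 : 'rV[R]_m), forall V,
    lie_derivative X w x V = \sum_i \sum_j V 0 i * V 1 j * lie_coef X (coef2 w) i j x.
Proof.
move=> sX wg.
have am := near_near wg.1.
have sW i j : smooth_germ (coef2 w i j) by exact: smooth_coef2.
have dX := smooth_near_derivable sX.
have diffW : \forall x \near (0 : 'rV[R]_m), forall ij : 'I_m * 'I_m,
    differentiable (coef2 w ij.1 ij.2) x.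
  near=> x => ij; move: ij; near: x; apply: filter_forall => ij.
  exact: smooth_near_differentiable (sW ij.1 ij.2).
have diffX : \forall x \near (0 : 'rV[R]_m), forall k : 'I_m,
    differentiable (fun x => X x 0 k) x.
  near=> x => k; move: k; near: x; apply: filter_forall => k.
  exact: smooth_near_differentiable ((smooth_mxP X).1 sX 0 k).
near=> x => V.
have amx : \forall z \near x, alternating_multilinear (w z) by near: x.
have dWx i j : differentiable (coef2 w i j) x.
  have H : forall ij : 'I_m * 'I_m, differentiable (coef2 w ij.1 ij.2) x by near: x.
  exact: (H (i, j)).
have dXx v : derivable X x v by move: v; near: x; exact: dX.
have dXk k : differentiable (fun x => X x 0 k) x by move: k; near: x.
have DX (v : 'rV[R]_m) k : 'D_v X x 0 k = \sum_i v 0 i * partial (fun x => X x 0 k) i x.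
  by rewrite derive_mx// mxE derive_rowE.
have D0 : 'D_(X x) (fun y => w y V) x = \sum_i \sum_j V 0 i * V 1 j *
    (\sum_k X x 0 k * partial (coef2 w i j) k x).
  (* The expansion in coefficients is valid on a neighbourhood of [x], so it may be differentiated
     at [x]. *)
  transitivity ('D_(X x) (fun y => \sum_(ij : 'I_m * 'I_m)
      V 0 ij.1 * V 1 ij.2 * coef2 w ij.1 ij.2 y) x).
    apply: near_eq_derive; apply: filterS amx => z wz.
    by rewrite (bilinear_expansion V wz) pair_bigA.
  have [|_ ->] := @derive_lincomb _ (index_enum ('I_m * 'I_m)%type)
    (fun ij => V 0 ij.1 * V 1 ij.2) (fun ij => coef2 w ij.1 ij.2) x (X x).
    by move=> ij; exact/diff_derivable.
  rewrite pair_bigA/=; apply: eq_bigr => -[i j] _ /=.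
  by rewrite derive_rowE.
have wx := nbhs_singleton amx.
have S0 : w x (\matrix_(j < 2) if j == 0 then 'D_(row 0 V) X x else row j V) =
    \sum_i \sum_j V 0 i * V 1 j *
    (\sum_k partial (fun x => X x 0 k) i x * coef2 w k j x).
  rewrite (bilinear_expansion _ wx).
  transitivity (\sum_k \sum_i \sum_j V 0 i * V 1 j *
      (partial (fun x => X x 0 k) i x * coef2 w k j x)).
    apply: eq_bigr => k _; rewrite exchange_big/=; apply: eq_bigr => j _.
    rewrite !mxE /= DX !mulr_suml; apply: eq_bigr => i _.
    by rewrite mxE /coef2 /form_coef; ring.
  rewrite exchange_big; apply: eq_bigr => i _.
  by rewrite exchange_big; apply: eq_bigr => j _; rewrite mulr_sumr.
have S1 : w x (\matrix_(j < 2) if j == 1 then 'D_(row 1 V) X x else row j V) =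
    \sum_i \sum_j V 0 i * V 1 j *
    (\sum_k partial (fun x => X x 0 k) j x * coef2 w i k x).
  rewrite (bilinear_expansion _ wx); apply: eq_bigr => i _.
  transitivity (\sum_k \sum_j V 0 i * V 1 j *
      (partial (fun x => X x 0 k) j x * coef2 w i k x)).
    apply: eq_bigr => k _.
    rewrite !mxE /= DX mulr_sumr !mulr_suml; apply: eq_bigr => j _.
    by rewrite mxE /coef2 /form_coef; ring.
  by rewrite exchange_big; apply: eq_bigr => j _; rewrite mulr_sumr.
rewrite /lie_derivative sum_ord2.
transitivity (\sum_i \sum_j V 0 i * V 1 j *
    (\sum_k X x 0 k * partial (coef2 w i j) k x) + (\sum_i \sum_j V 0 i * V 1 j *
    (\sum_k partial (fun x => X x 0 k) i x * coef2 w k j x) +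
  \sum_i \sum_j V 0 i * V 1 j *
    (\sum_k partial (fun x => X x 0 k) j x * coef2 w i k x))).
  by congr (_ + (_ + _)); [exact: D0|exact: S0|exact: S1].
rewrite -big_split/= -big_split/=; apply: eq_bigr => i _.
rewrite -big_split/= -big_split/=; apply: eq_bigr => j _.
by rewrite -!mulrDr /lie_coef !big_split.
Unshelve. all: end_near. Qed.

End Forms.

(** * Algebraic restrictions read on coefficients *)

Section RestrictionsOfForms.
Context {R : realType} {m : nat} (f : R -> 'rV[R]_m).

Lemma row'_entry k (A B : 'M[R]_(k, m)) i j l :
  row' i A = row' i B -> j != i -> A j l = B j l.
Proof.
move=> AB; rewrite eq_sym => /unlift_some[j' -> _].
by have /matrixP/(_ j' l) := AB; rewrite !mxE.
Qed.

Lemma row_entry k (A B C : 'M[R]_(k, m)) i (b c : R) l :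
  row i A = b *: row i B + c *: row i C -> A i l = b * B i l + c * C i l.
Proof. by move=> /rowP/(_ l); rewrite !mxE. Qed.

Lemma ord2P (r : 'I_2) : r = 0 \/ r = 1.
Proof. by case: r => [[|[|//]] ?]; [left|right]; apply/val_inj. Qed.

Definition form_of_coef2 (a : 'I_m -> 'I_m -> 'rV[R]_m -> R) : @Defs.form R m 2 :=
  fun x V => \sum_i \sum_j V 0 i * V 1 j * a i j x.

Definition form_of_coef1 (b : 'I_m -> 'rV[R]_m -> R) : @Defs.form R m 1 :=
  fun x V => \sum_i V 0 i * b i x.

Lemma form_coef_of_coef2 a s : form_coef (form_of_coef2 a) s = a (s 0) (s 1).
Proof.
apply/funext => x; rewrite /form_coef /form_of_coef2.
rewrite (bigD1 (s 0))//= [X in _ + X]big1 ?addr0; last first.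
  by move=> i /negPf is0; rewrite big1// => j _; rewrite !mxE eq_sym is0 !mul0r.
rewrite (bigD1 (s 1))//= [X in _ + X]big1 ?addr0; last first.
  by move=> j /negPf js1; rewrite !mxE [s 1 == j]eq_sym js1 mulr0 mul0r.
by rewrite !mxE !eqxx !mul1r.
Qed.

Lemma form_coef_of_coef1 b s : form_coef (form_of_coef1 b) s = b (s 0).
Proof.
apply/funext => x; rewrite /form_coef /form_of_coef1.
rewrite (bigD1 (s 0))//= [X in _ + X]big1 ?addr0; last first.
  by move=> i /negPf is0; rewrite !mxE eq_sym is0 mul0r.
by rewrite !mxE !eqxx !mul1r.
Qed.

Lemma form_of_coef2_germ a : (forall i j, smooth_germ (a i j)) ->
  (forall i j x, a i j x = - a j i x) -> form_germ (form_of_coef2 a).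
Proof.
move=> sa anti; split; last by move=> s; rewrite form_coef_of_coef2.
near=> x; split.
- move=> A B C r b c rA rB rC; rewrite /form_of_coef2.
  rewrite !mulr_sumr -big_split; apply: eq_bigr => i _ /=.
  rewrite !mulr_sumr -big_split; apply: eq_bigr => j _ /=.
  have [r0|r1] := eqVneq r 0.
    have e0 l := row_entry l rA; rewrite r0 in e0 rB rC.
    have n10 : (1 : 'I_2) != 0 by [].
    by rewrite e0 (row'_entry _ rB n10) (row'_entry _ rC n10); ring.
  have {}r1 : r = 1 by case: (ord2P r) r1 => -> //.
  have e1 l := row_entry l rA; rewrite r1 in e1 rB rC.
  have n01 : (0 : 'I_2) != 1 by [].
  by rewrite e1 (row'_entry _ rB n01) (row'_entry _ rC n01); ring.
- move=> A r r' rr' rA; have e01 l : A 0 l = A 1 l.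
    have /rowP/(_ l) := rA; rewrite !mxE.
    have [r0|r1] := ord2P r; have [r'0|r'1] := ord2P r'; subst r r' => //.
  (* With equal rows, exchanging the two summation indices changes only the sign. *)
  have S : form_of_coef2 a x A = - form_of_coef2 a x A.
    rewrite {2}/form_of_coef2 exchange_big -sumrN; apply: eq_bigr => i _ /=.
    rewrite -sumrN; apply: eq_bigr => j _ /=.
    by rewrite anti !e01; ring.
  by move: S; lra.
Unshelve. all: end_near. Qed.

Lemma form_of_coef1_germ b : (forall i, smooth_germ (b i)) ->
  form_germ (form_of_coef1 b).
Proof.
move=> sb; split; last by move=> s; rewrite form_coef_of_coef1.
near=> x; split.
- move=> A B C r b1 b2 rA rB rC; rewrite /form_of_coef1.
  rewrite !mulr_sumr -big_split; apply: eq_bigr => i _ /=.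
  by have := row_entry i rA; rewrite ord1 => ->; ring.
- by move=> A r r'; rewrite !ord1 eqxx.
Unshelve. all: end_near. Qed.

Lemma ext_d_form_of_coef1 b : (forall i, smooth_germ (b i)) ->
  \forall x \near (0 : 'rV[R]_m), forall V,
    ext_d (form_of_coef1 b) x V = \sum_i \sum_j V 0 i * V 1 j * ext_d1 b i j x.
Proof.
move=> sb.
have diffb : \forall x \near (0 : 'rV[R]_m), forall i, differentiable (b i) x.
  near=> x => i; move: i; near: x; apply: filter_forall => i.
  exact: smooth_near_differentiable (sb i).
near=> x => V.
have dbx i : differentiable (b i) x by move: i; near: x.
rewrite /ext_d sum_ord2 expr0 mul1r expr1 mulN1r.
have D v (U : 'M[R]_(1, m)) : 'D_v (fun y => form_of_coef1 b y U) x =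
    \sum_j \sum_i U 0 j * (v 0 i * 'D_(delta_mx 0 i) (b j) x).
  have [|_ ->] := @derive_lincomb _ _ _ (index_enum 'I_m) (fun j => U 0 j) b x v.
    by move=> j; exact/diff_derivable.
  by apply: eq_bigr => j _; rewrite derive_rowE// mulr_sumr.
rewrite !D [X in X - _]exchange_big -sumrB; apply: eq_bigr => i _ /=.
rewrite -sumrB; apply: eq_bigr => j _ /=.
rewrite !mxE /ext_d1.
have -> : lift (0 : 'I_2) (0 : 'I_1) = 1 by apply/val_inj.
have -> : lift (1 : 'I_2) (0 : 'I_1) = 0 by apply/val_inj.
ring.
Unshelve. all: end_near. Qed.

Lemma ext_d_coef2 (beta : @Defs.form R m 1) i j :
  coef2 (ext_d beta) i j = ext_d1 (fun i => form_coef beta (fun=> i)) i j.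
Proof.
apply/funext => x; rewrite /coef2 /form_coef /ext_d sum_ord2 expr0 mul1r expr1 mulN1r.
rewrite /ext_d1 /form_coef.
have -> : row 0 (rowsub (pair2 i j) 1%:M) = delta_mx 0 i :> 'rV[R]_m.
  by apply/rowP => l; rewrite !mxE eqxx /= eq_sym.
have -> : row 1 (rowsub (pair2 i j) 1%:M) = delta_mx 0 j :> 'rV[R]_m.
  by apply/rowP => l; rewrite !mxE eqxx /= eq_sym.
have -> : row' 0 (rowsub (pair2 i j) 1%:M) = rowsub (fun=> j) 1%:M :> 'M[R]_(1, m).
  by apply/matrixP => r l; rewrite !mxE.
have -> // : row' 1 (rowsub (pair2 i j) 1%:M) = rowsub (fun=> i) 1%:M :> 'M[R]_(1, m).
by apply/matrixP => r l; rewrite !mxE ord1.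
Qed.

(** The two notions differ in that [zero_restr] lets [alpha] be any family of coefficients, while
    [form_germ] asks for an alternating form. *)
Lemma same_restriction_zeroP (w : @Defs.form R m 2) a :
  (\forall x \near (0 : 'rV[R]_m), forall V, w x V = form_of_coef2 a x V) ->
  (\forall x \near (0 : 'rV[R]_m), forall i j, a i j x = - a j i x) ->
  same_algebraic_restriction f w zero_form <-> zero_restr f a.
Proof.
move=> wa anti; split.
- move=> [alpha [beta [galpha gbeta valpha vbeta E]]].
  exists (coef2 alpha), (fun i => form_coef beta (fun=> i)); split.
  + by move=> i j; exact: galpha.2.
  + by move=> i; exact: gbeta.2.
  + by move=> i j; apply: filterS valpha => t; apply.
  + by move=> i; apply: filterS vbeta => t; apply.
  near=> x => i j.
  have wax : forall V, w x V = form_of_coef2 a x V by near: x.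
  have Ex : forall V, w x V - zero_form x V = alpha x V + ext_d beta x V by near: x.
  have := Ex (rowsub (pair2 i j) 1%:M); rewrite subr0 wax.
  have := form_coef_of_coef2 a (pair2 i j).
  move=> /(congr1 (fun h => h x)); rewrite /form_coef => ->.
  by rewrite -ext_d_coef2.
- move=> [al [b [sal sb val vb E]]].
  (* Antisymmetrising preserves vanishing on the curve, and also the decomposition, because [a] and
     [ext_d1 b] are antisymmetric. *)
  pose al' i j x := 2^-1 * (al i j x - al j i x).
  have sal' i j : smooth_germ (al' i j).
    exact: (smoothM (smooth_cst _ _) (smoothB (sal i j) (sal j i))).
  exists (form_of_coef2 al'), (form_of_coef1 b); split.
  + by apply: form_of_coef2_germ => [//|i j x]; rewrite /al'; ring.
  + exact: form_of_coef1_germ.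
  + have val2 : \forall t \near (0 : R), forall ij : 'I_m * 'I_m,
        al ij.1 ij.2 (f t) = 0.
      near=> t => ij; move: ij; near: t; apply: filter_forall => ij; exact: val.
    apply: filterS val2 => t H s; rewrite form_coef_of_coef2 /al'.
    by rewrite (H (_, _)) (H (_, _)) subrr mulr0.
  + have vb2 : \forall t \near (0 : R), forall i, b i (f t) = 0.
      near=> t => i; move: i; near: t; apply: filter_forall => i; exact: vb.
    by apply: filterS vb2 => t H s; rewrite form_coef_of_coef1.
  have Eb := ext_d_form_of_coef1 sb.
  near=> x => V.
  have wax : forall V, w x V = form_of_coef2 a x V by near: x.
  have Ebx : forall V, ext_d (form_of_coef1 b) x V =
    \sum_i \sum_j V 0 i * V 1 j * ext_d1 b i j x by near: x.
  have ax i j : a i j x = - a j i x by move: i j; near: x.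
  have Ex i j : a i j x = al i j x + ext_d1 b i j x by move: i j; near: x.
  rewrite subr0 wax Ebx -big_split; apply: eq_bigr => i _ /=.
  rewrite -big_split; apply: eq_bigr => j _ /=.
  rewrite -mulrDr; congr (_ * _).
  have := ax i j; rewrite !Ex /al' /ext_d1; lra.
Unshelve. all: end_near. Qed.

End RestrictionsOfForms.

(** * Finite-dimensional quotients *)

Section FiniteSpan.
Context {R : realType} {V : lmodType R}.
Implicit Types (K L : set V) (r s : seq V) (u v : V).

Lemma linear_subspaceB K (a : R) u v : linear_subspace K -> K u -> K v -> K (u - a *: v).
Proof. by move=> [K0 KD] Ku Kv; rewrite addrC -scaleNr; exact: KD. Qed.

Fixpoint in_span_mod K r v : Prop :=
  if r is e :: r' then exists c : R, in_span_mod K r' (v - c *: e) else K v.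

Lemma in_span_mod_subspace K r : linear_subspace K -> linear_subspace (in_span_mod K r).
Proof.
move=> [K0 KD]; elim: r => [//|e r [IH0 IHD]]; split.
  by exists 0; rewrite scale0r subr0.
move=> a u v [c Hc] [d Hd]; exists (a * c + d).
have -> : a *: u + v - (a * c + d) *: e = a *: (u - c *: e) + (v - d *: e).
  by rewrite scalerBr scalerDl scalerA opprD addrACA.
exact: IHD.
Qed.

(** The entries of [r] need not lie in [L], those of [s] do. Each generator that [L] really uses is
    exchanged for an element of [L], and the induction continues on the part of [L] spanned by the
    others. *)
Lemma subspace_of_finite_span K r L : linear_subspace K -> linear_subspace L ->
  (forall v, L v -> in_span_mod K r v) ->
  exists s, (forall i, (i < size s)%N -> L (nth 0 s i)) /\
    forall v, L v -> in_span_mod K s v.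
Proof.
move=> sK; elim: r L => [|e r IH] L sL Lr; first by exists [::].
have [LL|/existsNP[v0 /not_implyP[Lv0 nv0]]] := pselect (forall v, L v -> in_span_mod K r v).
  exact: IH.
(* As [v0] is not spanned by [r] alone, its coefficient [c0] on [e] is nonzero, and [v0] can take
   the place of [e]. *)
have [c0 Hc0] := Lr v0 Lv0.
have sr := in_span_mod_subspace r sK.
have c00 : c0 != 0.
  by apply/eqP => c00; apply: nv0; move: Hc0; rewrite c00 scale0r subr0.
pose L' := [set v | L v /\ in_span_mod K r v].
have sL' : linear_subspace L'.
  split; first by split; [exact: sL.1|exact: sr.1].
  by move=> a u v [Lu ru] [Lv rv]; split; [exact: sL.2|exact: sr.2].
have [|s [sLs spans]] := IH L' sL'; first by move=> v [].
exists (v0 :: s); split.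
  by case=> [_|i]; [exact: Lv0|move=> /sLs[]].
move=> v Lv; have [c Hc] := Lr v Lv; exists (c / c0); apply: spans; split.
  exact: linear_subspaceB.
have -> : v - (c / c0) *: v0 = (v - c *: e) - (c / c0) *: (v0 - c0 *: e).
  by rewrite scalerBr scalerA divfK// opprB addrA subrK.
exact: linear_subspaceB.
Qed.

Lemma in_span_mod_sum K s v : in_span_mod K s v ->
  exists c : 'I_(size s) -> R, K (v - \sum_i c i *: nth 0 s i).
Proof.
elim: s v => [|e s IH] v /=; first by exists (fun=> 0); rewrite big_ord0 subr0.
move=> [c0 /IH[c Hc]].
exists (fun i => if unlift ord0 i is Some j then c j else c0).
rewrite big_ord_recl unlift_none /= opprD addrA.
by under eq_bigr => i _ do rewrite liftK.
Qed.

Lemma sum_in_span_mod K (I : Type) (r : seq I) (e : I -> V) (c : I -> R) v :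
  K (v - \sum_(i <- r) c i *: e i) -> in_span_mod K [seq e i | i <- r] v.
Proof.
elim: r v => [|i r IH] v /=; first by rewrite big_nil subr0.
by rewrite big_cons opprD addrA => H; exists (c i); exact: IH.
Qed.

(** [K] and the [e i] may lie outside [L]. Once generators of [L] modulo [K] are found inside [L],
    the remainders lie in both [L] and [K], hence in [T]. *)
Lemma finite_dimensional_quotientW L T K (I : finType) (e : I -> V) :
  linear_subspace L -> linear_subspace T -> T `<=` L -> linear_subspace K ->
  (forall v, L v -> K v -> T v) ->
  (forall v, L v -> exists c : I -> R, K (v - \sum_i c i *: e i)) ->
  finite_dimensional_quotient L T.
Proof.
move=> sL sT TL sK LKT LK; split=> //.
have [|s [sLs spans]] := @subspace_of_finite_span K [seq e i | i <- index_enum I] L sK sL.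
  by move=> v /LK[c Hc]; exact: sum_in_span_mod Hc.
exists (size s), (fun i : 'I_(size s) => nth 0 s i); split=> [i|v Lv]; first exact: sLs.
have [c Hc] := in_span_mod_sum (spans v Lv).
exists c; apply: (LKT _ _ Hc).
have Lsum : L (\sum_i c i *: nth 0 s i).
  apply: (big_ind L) => [|u u' Lu Lu'|i _]; first exact: sL.1.
  - by rewrite -[u]scale1r; exact: sL.2.
  - by rewrite -[_ *: _]addr0; apply: sL.2; [exact: sLs|exact: sL.1].
by rewrite -[X in _ - X]scale1r; exact: linear_subspaceB.
Qed.

End FiniteSpan.

(** * Vector fields acting trivially *)

Section LieCoefficients.
Context {R : realType} {m : nat} (f : R -> 'rV[R]_m).
Implicit Types (X Y : 'rV[R]_m -> 'rV[R]_m) (w : @Defs.form R m 2).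

Lemma near_lie_coefC X w : form_germ w ->
  \forall x \near (0 : 'rV[R]_m), forall i j,
    lie_coef X (coef2 w) i j x = - lie_coef X (coef2 w) j i x.
Proof.
move=> wg; have anti := near_near (near_coef2C wg).
have dW : \forall x \near (0 : 'rV[R]_m), forall ij : 'I_m * 'I_m, forall v,
    derivable (coef2 w ij.1 ij.2) x v.
  near=> x => ij; move: ij; near: x; apply: filter_forall => ij.
  exact: smooth_near_derivable (smooth_coef2 ij.1 ij.2 wg).
near=> x => i j.
have ax : \forall z \near x, forall i j, coef2 w i j z = - coef2 w j i z by near: x.
have dWx i' j' v : derivable (coef2 w i' j') x v.
  have H : forall ij : 'I_m * 'I_m, forall v, derivable (coef2 w ij.1 ij.2) x v by near: x.
  exact: (H (i', j')).
have a0 := nbhs_singleton ax.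
rewrite /lie_coef -sumrN; apply: eq_bigr => k _.
have -> : partial (coef2 w i j) k x = - partial (coef2 w j i) k x.
  rewrite /partial -(deriveN (dWx j i _)); apply: near_eq_derive.
  by apply: filterS ax => z ->.
rewrite (a0 k j) (a0 i k); ring.
Unshelve. all: end_near. Qed.

Lemma smooth_entry X k : smooth_germ X -> smooth_germ (fun x => X x 0 k).
Proof. by move=> sX; exact: ((smooth_mxP X).1 sX 0 k). Qed.

Lemma smooth_lincomb (a : R) X Y : smooth_germ X -> smooth_germ Y ->
  smooth_germ (a *: X + Y).
Proof.
move=> sX sY; apply/smooth_mxP => p q; rewrite [p]ord1.
apply: (smooth_near_eq (smoothD (smoothM (smooth_cst _ a) (smooth_entry q sX))
  (smooth_entry q sY))).
by near=> x; rewrite !mxE.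
Unshelve. all: end_near. Qed.

Lemma lie_coef_lincomb (a : R) X Y w : smooth_germ X -> smooth_germ Y ->
  \forall x \near (0 : 'rV[R]_m), forall i j,
    a * lie_coef X (coef2 w) i j x + lie_coef Y (coef2 w) i j x =
    lie_coef (a *: X + Y) (coef2 w) i j x.
Proof.
move=> sX sY.
have dXY : \forall x \near (0 : 'rV[R]_m),
    (forall k v, derivable (fun x => X x 0 k) x v) /\
    forall k v, derivable (fun x => Y x 0 k) x v.
  exact: filterI (near_derivable_all (fun k => smooth_entry k sX))
    (near_derivable_all (fun k => smooth_entry k sY)).
near=> x => i j.
have [dXx dYx] : (forall k v, derivable (fun x => X x 0 k) x v) /\
    forall k v, derivable (fun x => Y x 0 k) x v by near: x; exact: dXY.
have D l k : partial (fun x => (a *: X + Y) x 0 k) l x =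
    a * partial (fun x => X x 0 k) l x + partial (fun x => Y x 0 k) l x.
  rewrite /partial (_ : (fun x => (a *: X + Y) x 0 k) =
    (fun x => a *: (X x 0 k)) + (fun x => Y x 0 k)); last first.
    by apply/funext => z; rewrite !fctE !mxE.
  have dZ v : derivable (fun z => a *: (X z 0 k)) x v by exact: derivableZ.
  rewrite deriveD//; congr (_ + _); exact: (deriveZ a (dXx k _)).
rewrite /lie_coef mulr_sumr -big_split; apply: eq_bigr => k _ /=.
by rewrite !D !mxE; ring.
Unshelve. all: end_near. Qed.

(** Gives access to the rules for [zero_restr]: its stability under sums and multiples makes the
    trivially acting fields a subspace. *)
Lemma acts_triviallyP X : smooth_germ X -> acts_trivially f X <->
  forall w, form_germ w -> closed_form w -> zero_restr f (lie_coef X (coef2 w)).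
Proof.
move=> sX; split=> H w gw cw.
  by apply/(same_restriction_zeroP f (lie_derivative_expansion sX gw) (near_lie_coefC X gw));
    exact: H.
by apply/(same_restriction_zeroP f (lie_derivative_expansion sX gw) (near_lie_coefC X gw));
    exact: H.
Qed.

Lemma liftable_subspace : linear_subspace [set X | liftable f X].
Proof.
split.
  split; first by apply/smooth_mxP => p q; apply: (smooth_near_eq (smooth_cst _ 0));
    near=> x; rewrite mxE.
  exists (fun=> 0); first exact: smooth_cst.
  by near=> t; rewrite scale0r.
move=> a X Y [sX [g sg gX]] [sY [h sh hY]]; split; first exact: smooth_lincomb.
exists (fun t => a * g t + h t).
  exact: (smoothD (smoothM (smooth_cst _ a) sg) sh).
apply: filterS2 gX hY => t gX hY.
by rewrite scalerDl -scalerA gX hY.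
Unshelve. all: end_near. Qed.

Lemma trivial_subspace :
  linear_subspace [set X | liftable f X /\ acts_trivially f X].
Proof.
have [L0 LD] := liftable_subspace; split.
  split=> //; apply/acts_triviallyP; first by case: L0.
  move=> w gw cw; apply: (@zero_restr_near_eq _ _ _ (fun _ _ => fun=> 0)).
    by apply: zero_restr_vanishes => i j; [exact: smooth_cst|exact: vanishes0].
  near=> x => i j; rewrite /lie_coef big1// => k _.
  rewrite /partial (_ : (fun x => (0 : 'rV[R]_m -> 'rV[R]_m) x 0 k) = fun=> 0); last first.
    by apply/funext => z; rewrite mxE.
  by rewrite mxE !(derive_cst (0 : R)) !mul0r !addr0.
move=> a X Y [LX tX] [LY tY]; split; first exact: LD.
have sX := LX.1; have sY := LY.1.
apply/acts_triviallyP; first exact: smooth_lincomb.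
move=> w gw cw; move/(acts_triviallyP sX)/(_ w gw cw) : tX => tX.
move/(acts_triviallyP sY)/(_ w gw cw) : tY => tY.
exact: (zero_restr_near_eq (zero_restrD (zero_restrZ a tX) tY) (lie_coef_lincomb a w sX sY)).
Unshelve. all: end_near. Qed.

Lemma mpow_lie_coef (y : 'I_m -> 'rV[R]_m -> R) n X w i j :
  (forall i, smooth_germ (y i)) -> form_germ w ->
  (forall k, mpow y n.+1 (fun x => X x 0 k)) ->
  mpow y n (lie_coef X (coef2 w) i j).
Proof.
move=> sy gw HX; apply: mpow_sum => k.
have sW p q : smooth_germ (coef2 w p q) by exact: smooth_coef2.
apply: mpowD; first exact: (mpowMr (mpow_pred sy (HX k)) (smooth_derive _ (sW i j))).
apply: mpowD.
  exact: (mpowMr (mpow_derive sy _ (HX k)) (sW k j)).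
exact: (mpowMr (mpow_derive sy _ (HX k)) (sW i k)).
Qed.

End LieCoefficients.

Theorem theorem3 (R : realType) (m : nat) (f : R -> 'rV[R]_m)
    (f_curve : curve_germ f) (f_qh : quasi_homogeneous f) :
  finite_dimensional_quotient
    [set X : 'rV[R]_m -> 'rV[R]_m | liftable f X]
    [set X : 'rV[R]_m -> 'rV[R]_m | liftable f X /\ acts_trivially f X].
Proof.
have [tau [chi [psi [lambda [c [chart lambda0 y_curve]]]]]] :=
  quasi_homogeneous_monomial f_curve f_qh.
pose y i x := chi x 0 i.
have sy : forall i, smooth_germ (y i) by exact: smooth_chart_coord chart.
have [N HN] := zero_restr_y_pow_wedge sy lambda0 y_curve.
(* The least degree exceeding [m * N], the threshold of [zero_restr_flat]. *)
pose n := (m * N).+1.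
(* The Lie derivative differentiates [X] once, so the fields carry one power more than the
   coefficients of [L_X w] need. *)
pose K := [set X : 'rV[R]_m -> 'rV[R]_m | forall j, mpow y n.+1 (fun x => X x 0 j)].
have [I [e [se spans]]] := mpow_finite_codim sy (chart_division chart) n.+1.
(* Monomials in the adapted coordinates times the standard constant fields: generators of all smooth
   fields modulo [K], with no claim of liftability. *)
pose E (ij : I * 'I_m) : 'rV[R]_m -> 'rV[R]_m :=
  fun x => e ij.1 x *: delta_mx 0 ij.2.
apply: (@finite_dimensional_quotientW _ _ _ _ K _ E).
- exact: liftable_subspace.
- exact: trivial_subspace.
- by move=> X [].
- split=> [j|a X Y KX KY j].
    by apply: mpow_near_eq (mpow0 y n.+1) _; near=> x; rewrite mxE.
  apply: mpow_near_eq (mpowD (mpowM (smooth_cst _ a) (KX j)) (KY j)) _.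
  by near=> x; rewrite !mxE.
- move=> X LX KX; split=> //; apply/acts_triviallyP; first by case: LX.
  move=> w gw _; apply: (zero_restr_flat chart HN (ltnSn (m * N))).
    by move=> i j; exact: (mpow_lie_coef i j sy gw KX).
  exact: near_lie_coefC.
- move=> X [sX _].
  have [c' Hc'] := choice (fun j => spans _ (smooth_entry j sX)).
  exists (fun ij => c' ij.2 ij.1) => j.
  apply: mpow_near_eq (Hc' j) _; near=> x.
  rewrite -[(_ - _) x]/(X x - (\sum_i c' i.2 i.1 *: E i) x) fct_sumE !mxE summxE.
  congr (_ - _).
  transitivity (\sum_i \sum_k c' k i * (e i x * (j == k)%:R)).
    apply: eq_bigr => i _; rewrite (bigD1 j)//= eqxx mulr1 big1 ?addr0// => k.
    by rewrite eq_sym => /negPf ->; rewrite !mulr0.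
  rewrite pair_bigA; apply: eq_bigr => -[i k] _ /=.
  by rewrite !mxE eqxx.
Unshelve. all: end_near. Qed.
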